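(* Let $K$ be an arbitrary field. (1) The graph $\mathcal{G}_{1,K}$ consists of a unique maximal coclass tree $\mathcal{T}$ with root $K Z_{3}$ and corresponding infinite dimensional algebra $M_{K,1}$ (that is, $M_{K,1}$ describes the unique maximal infinite path of $\mathcal{T}$). (2) The tree $\mathcal{T}$ is strongly virtually periodic with strong defect $2$ and strong period $2$. Let $A_1 \to A_2 \to \cdots$ denote the maximal infinite path of $\mathcal{T}$. For each algebra $B\in \mathcal{T}(A_2)\setminus\mathcal{T}(A_4)$ the polynomial $f_B$ corresponding to $B$ has degree at most $1$. (a) If $\sqrt{-1} \in K$, then $\mathcal{T}(A_2)\setminus\mathcal{T}(A_4)$ consists of $A_2$, $4$ algebras with $A_2$ as parent, and $3$ algebras with $A_3$ as parent. (b) If $\sqrt{-1} \notin K$, then $\mathcal{T}(A_2)\setminus\mathcal{T}(A_4)$ consists of $A_2$, $4$ algebras with $A_2$ as parent, and $4$ algebras with $A_3$ as parent.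
   Context: Algebras are associative and not necessarily unital. A semigroup with zero or an associative algebra $O$ is nilpotent if there is an integer $c$ such that every product of $c+1$ elements of $O$ is zero; the least such $c$ is the class $cl(O)$, i.e. the length of the series $O > O^2 > \dots > O^c > O^{c+1}=\{0\}$. The coclass of a finite nilpotent semigroup with $n$ non-zero elements, or of a nilpotent algebra of finite dimension $n$, is $n-cl(O)$. For a semigroup $S$ with zero $z$, the contracted semigroup algebra $KS$ is the quotient of the semigroup algebra $K[S]$ by the ideal $Kz$. $Z_n$ is the zero semigroup with $n$ elements (all products are $0$). The directed labelled graph $\mathcal{G}_{r,K}$: its vertices correspond one-to-one to the isomorphism types of algebras $KS$, where $S$ ranges over the finite nilpotent semigroups of coclass $r$; there is a directed edge $A \to B$ between vertices ($A$ is then the parent of $B$) if $B/B^c \cong A$, where $c$ is the class of $B$; each vertex $A$ is labelled by the number of isomorphism types of semigroups $S$ of coclass $r$ with $A\cong KS$. Every connected component of $\mathcal{G}_{r,K}$ is a rooted tree. An infinite path is maximal if it starts at the root of its tree. For a vertex $A$, $\mathcal{T}(A)$ is the rooted tree formed by all paths starting at $A$. $\mathcal{T}(A)$ is a coclass tree if it contains a unique maximal infinite path (an infinite path starting at its root $A$); a coclass tree $\mathcal{T}(A)$ is maximal if either $A$ is a root in $\mathcal{G}_{r,K}$ or the parent of $A$ lies on more than one maximal infinite path. For a labelled tree $\mathcal{T}$, $\overline{\mathcal{T}}$ denotes the tree without labels. Let $\mathcal{T}$ be a maximal coclass tree with maximal infinite path $A_1\to A_2\to\cdots$. $\mathcal{T}$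 is strongly virtually periodic with strong defect $l$ and strong period $k$ ($l,k$ positive integers) if there exist a graph isomorphism $\mu:\overline{\mathcal{T}}(A_l)\to\overline{\mathcal{T}}(A_{l+k})$ and, for every vertex $B$ in $\mathcal{T}(A_l)\setminus\mathcal{T}(A_{l+k})$, a rational polynomial $f_B$ such that the label of $\mu^i(B)$ equals $f_B(i)$ for all $i\ge 0$. The polynomial $f_B$ is the polynomial corresponding to $B$. $I_K$ is the ideal of polynomials with zero constant term in the polynomial algebra $K[x]$; $L_K$ is the $1$-dimensional $K$-algebra with zero multiplication; $M_{K,1}=I_K\oplus L_K$. An infinite dimensional associative $K$-algebra $A$ describes an infinite path $A_1\to A_2\to\cdots$ if $A/A^{j+c}\cong A_j$ for every $j\ge 1$, where $c$ is the class of $A_1$. The condition $\sqrt{-1}\in K$ means that $-1$ is a square in $K$. *)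

(* Defs.v *)
From HB Require Import structures.
From Stdlib Require Import Relation_Operators.
From mathcomp Require Import all_boot all_algebra.
From mathcomp Require Import generic_quotient ring_quotient.
From mathcomp Require Import boolp.

Set Implicit Arguments.
Unset Strict Implicit.
Unset Printing Implicit Defensive.

Import GRing.Theory.

Local Open Scope ring_scope.
Local Open Scope quotient_scope.

HB.mixin Record Semigroup_hasZero S of Semigroup S := {
  szero : S;
  mul0s : left_zero szero (@monoid.mul S);
  muls0 : right_zero szero (@monoid.mul S)
}.

#[short(type="finSemigroup0")]
HB.structure Definition FinSemigroup0 :=
  {S of Finite S & Semigroup S & Semigroup_hasZero S}.

Arguments szero {s}.

(* x * y_1 * ... * y_m, a product of m + 1 elements *)
Definition lprod (S : semigroupType) (x : S) (s : seq S) : S :=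
  foldl (@monoid.mul S) x s.

Definition vanishing (S : semigroupType) (z : S) (c : nat) : Prop :=
  forall (x : S) (s : seq S), size s = c -> lprod x s = z.

(* cl(S) = c, where z is the zero of S. This includes that S is nilpotent. It
   serves both for semigroups with zero and for algebras. *)
Definition has_class (S : semigroupType) (z : S) (c : nat) : Prop :=
  vanishing z c /\ forall d, vanishing z d -> (c <= d)%N.

(* The coclass equation n - cl(S) = r, without truncated subtraction. *)
Definition has_coclass (S : finSemigroup0) (r : nat) : Prop :=
  exists c, has_class (szero : S) c /\ #|[set x : S | x != szero]| = (c + r)%N.

Definition sg_iso (S T : finSemigroup0) : Prop :=
  exists2 f : S -> T, bijective f & {morph f : x y / (x * y)%g}.

Definition sgtype : Type := finSemigroup0 -> Prop.

Definition sg_isotype (S : finSemigroup0) : sgtype := sg_iso S.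

(* Z_n, with n elements, for n >= 1; the value at n = 0 is Z_1. *)
Definition zero_semigroup (n : nat) : Type := 'I_n.-1.+1.

Section ZeroSemigroup.
Variable n : nat.
Local Notation Z := (zero_semigroup n).

HB.instance Definition _ := Finite.on Z.

Definition zs_mul (x y : Z) : Z := (ord0 : 'I_n.-1.+1).

Fact zs_mulA : associative zs_mul. Proof. by []. Qed.
Fact zs_mul0 : left_zero (ord0 : 'I_n.-1.+1) zs_mul. Proof. by []. Qed.
Fact zs_mul0r : right_zero (ord0 : 'I_n.-1.+1) zs_mul. Proof. by []. Qed.

HB.instance Definition _ := isSemigroup.Build Z zs_mulA.
HB.instance Definition _ := Semigroup_hasZero.Build Z zs_mul0 zs_mul0r.
End ZeroSemigroup.

(* The multiplication is the one of the underlying semigroup (%g). *)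
HB.mixin Record isBilinearMul (K : fieldType) A
    of GRing.Lmodule K A & Semigroup A := {
  amulDl : left_distributive (@monoid.mul A) (@GRing.add A);
  amulDr : right_distributive (@monoid.mul A) (@GRing.add A);
  amulZl : forall (a : K) (x y : A), ((a *: x) * y)%g = a *: (x * y)%g;
  amulZr : forall (a : K) (x y : A), (x * (a *: y))%g = a *: (x * y)%g
}.

#[short(type="assocAlgType")]
HB.structure Definition AssocAlg (K : fieldType) :=
  {A of GRing.Lmodule K A & Semigroup A & isBilinearMul K A}.

Section AssocAlgTheory.
Variables (K : fieldType) (A : assocAlgType K).
Implicit Types (x y : A).

Lemma amul0l y : (0 * y)%g = 0 :> A.
Proof. by rewrite -(scale0r (0 : A)) amulZl !scale0r. Qed.

Lemma amul0r y : (y * 0)%g = 0 :> A.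
Proof. by rewrite -(scale0r (0 : A)) amulZr !scale0r. Qed.

Lemma amulNr x y : (x * - y)%g = - (x * y)%g.
Proof. by rewrite -scaleN1r amulZr scaleN1r. Qed.

Lemma amul_suml (I : Type) (s : seq I) (F : I -> A) y :
  ((\sum_(i <- s) F i) * y)%g = \sum_(i <- s) (F i * y)%g.
Proof.
elim: s => [|i s IH]; first by rewrite !big_nil amul0l.
by rewrite !big_cons amulDl IH.
Qed.

Lemma amul_sumr (I : Type) (s : seq I) (F : I -> A) y :
  (y * (\sum_(i <- s) F i))%g = \sum_(i <- s) (y * F i)%g.
Proof.
elim: s => [|i s IH]; first by rewrite !big_nil amul0r.
by rewrite !big_cons amulDr IH.
Qed.
End AssocAlgTheory.

Definition alg_iso (K : fieldType) (A B : assocAlgType K) : Prop :=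
  exists2 f : {linear A -> B}, bijective f & {morph f : x y / (x * y)%g}.

(* An isomorphism type is represented by its isomorphism class, so that
   isomorphism types are compared by equality. Plain predicates are used
   instead of classical_sets, whose sets cannot hold a type of structures in a
   universe that also contains the quotients below. *)
Definition algtype (K : fieldType) := assocAlgType K -> Prop.

Definition isotype (K : fieldType) (A : assocAlgType K) : algtype K :=
  alg_iso A.

Definition infinite_dimensional (K : fieldType) (A : assocAlgType K) : Prop :=
  ~ exists (n : nat) (e : 'I_n -> A),
      forall x : A, exists a : 'I_n -> K, x = \sum_i a i *: e i.

Record algIdeal (K : fieldType) (A : assocAlgType K) := AlgIdeal {
  ideal_pred :> {pred A};
  ideal_submod : submod_closed ideal_pred;
  idealMl : forall x y : A, y \in ideal_pred -> (x * y)%g \in ideal_pred;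
  idealMr : forall x y : A, x \in ideal_pred -> (x * y)%g \in ideal_pred
}.

HB.instance Definition _ (K : fieldType) (A : assocAlgType K) (I : algIdeal A) :=
  GRing.isSubmodClosed.Build K A (ideal_pred I) (ideal_submod I).

Definition quot_alg (K : fieldType) (A : assocAlgType K) (I : algIdeal A) : Type :=
  Quotient.quot (ideal_pred I).

Section QuotAlg.
Variables (K : fieldType) (A : assocAlgType K) (I : algIdeal A).
Local Notation Q := (quot_alg I).

HB.instance Definition _ := GRing.Zmodule.on Q.

Let p (x : A) : Q := \pi_(Quotient.quot (ideal_pred I)) x.
Let r (x : Q) : A := repr (x : Quotient.quot (ideal_pred I)).

Let rK : cancel r p. Proof. exact: reprK. Qed.
Let pP (x y : A) : (p x = p y) <-> (x - y \in I).
Proof. by rewrite Quotient.idealrBE; split => [/eqP|/eqP]. Qed.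
Let rp (x : A) : r (p x) - x \in I.
Proof. by apply/pP; rewrite rK. Qed.
Let pD (x y : A) : p (x + y) = p x + p y.
Proof. by rewrite /p raddfD. Qed.

Definition qscale (a : K) (x : Q) : Q :=
  \pi_(Quotient.quot (ideal_pred I)) (a *: r x).
Definition qmul (x y : Q) : Q := \pi_(Quotient.quot (ideal_pred I)) (r x * r y)%g.

Let pZ a x : qscale a (p x) = p (a *: x).
Proof. by apply/pP; rewrite -scalerBr rpredZ. Qed.
Let pM x y : qmul (p x) (p y) = p (x * y)%g.
Proof.
apply/pP; set u := r (p x); set v := r (p y).
have -> : (u * v)%g - (x * y)%g = ((u - x) * v)%g + (x * (v - y))%g.
  rewrite amulDl amulDr -addrA; congr (_ + _).
  rewrite addrA -amulDl addNr amul0l add0r.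
  by rewrite amulNr.
by apply: rpredD; [apply: idealMr | apply: idealMl]; apply: rp.
Qed.

Fact qscaleA a b v : qscale a (qscale b v) = qscale (a * b) v.
Proof. by rewrite -(rK v) !pZ scalerA. Qed.
Fact qscale1 : left_id 1 qscale.
Proof. by move=> v; rewrite -(rK v) !pZ scale1r. Qed.
Fact qscaleDr : right_distributive qscale +%R.
Proof. by move=> a u v; rewrite -(rK u) -(rK v) -pD !pZ -pD scalerDr. Qed.
Fact qscaleDl v : {morph qscale^~ v : a b / a + b}.
Proof. by move=> a b; rewrite -(rK v) !pZ -pD scalerDl. Qed.

HB.instance Definition _ :=
  GRing.Zmodule_isLmodule.Build K Q qscaleA qscale1 qscaleDr qscaleDl.

Fact qmulA : associative qmul.
Proof. by move=> x y z; rewrite -(rK x) -(rK y) -(rK z) !pM mulgA. Qed.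

HB.instance Definition _ := isSemigroup.Build Q qmulA.

Fact qmulDl : left_distributive qmul +%R.
Proof.
by move=> x y z; rewrite -(rK x) -(rK y) -(rK z) -pD !pM -pD amulDl.
Qed.
Fact qmulDr : right_distributive qmul +%R.
Proof.
by move=> x y z; rewrite -(rK x) -(rK y) -(rK z) -pD !pM -pD amulDr.
Qed.
Fact qmulZl (a : K) (x y : Q) : qmul (a *: x) y = a *: qmul x y.
Proof.
by rewrite -[_ *: x]/(qscale a x) -[RHS]/(qscale _ _) -(rK x) -(rK y)
  !(pM, pZ) amulZl.
Qed.
Fact qmulZr (a : K) (x y : Q) : qmul x (a *: y) = a *: qmul x y.
Proof.
by rewrite -[_ *: y]/(qscale a y) -[RHS]/(qscale _ _) -(rK x) -(rK y)
  !(pM, pZ) amulZr.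
Qed.

HB.instance Definition _ :=
  isBilinearMul.Build K Q qmulDl qmulDr qmulZl qmulZr.
End QuotAlg.

(* A^m, the span of all products of m elements of A, for m >= 1; the value at
   m = 0 is A. *)
Definition alg_power (K : fieldType) (A : assocAlgType K) (m : nat) : {pred A} :=
  fun x => `[< exists s : seq (K * A),
    (forall p, p \in s -> exists y t, size t = m.-1 /\ p.2 = lprod y t) /\
    x = \sum_(p <- s) p.1 *: p.2 >].

Section AlgPower.
Variables (K : fieldType) (A : assocAlgType K) (m : nat).
Local Notation P := (@alg_power K A m).

Fact alg_power_submod : submod_closed P.
Proof.
split=> [|a u v]; first by apply/asboolP; exists [::]; rewrite big_nil.
move=> /asboolP[s [sP ->]] /asboolP[t [tP ->]]; apply/asboolP.
exists ([seq (a * p.1, p.2) | p <- s] ++ t); split.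
  by move=> p; rewrite mem_cat => /orP[/mapP[q /sP qP ->]|/tP].
rewrite big_cat big_map scaler_sumr; congr (_ + _).
by apply: eq_bigr => p _; rewrite scalerA.
Qed.

Fact alg_power_Ml x y : y \in P -> (x * y)%g \in P.
Proof.
move=> /asboolP[s [sP ->]]; apply/asboolP.
exists [seq (p.1, (x * p.2)%g) | p <- s]; split; last first.
  by rewrite big_map amul_sumr; apply: eq_bigr => p _; rewrite amulZr.
move=> p /mapP[q /sP[z [t [tm qE]]] ->]; exists (x * z)%g, t; split=> //=.
by rewrite qE /lprod; elim: t z {tm qE} => //= w t IH z; rewrite IH mulgA.
Qed.

Fact alg_power_Mr x y : x \in P -> (x * y)%g \in P.
Proof.
move=> /asboolP[s [sP ->]]; apply/asboolP.
exists [seq (p.1, (p.2 * y)%g) | p <- s]; split; last first.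
  by rewrite big_map amul_suml; apply: eq_bigr => p _; rewrite amulZl.
move=> p /mapP[q /sP[z [t [tm qE]]] ->] /=.
case/lastP: t tm qE => [|t w] tm qE; first by exists (z * y)%g, [::]; rewrite qE.
exists z, (rcons t (w * y)%g); split; first by rewrite -tm !size_rcons.
by rewrite qE /lprod -!cats1 !foldl_cat /= mulgA.
Qed.

Definition power_ideal : algIdeal A :=
  AlgIdeal alg_power_submod alg_power_Ml alg_power_Mr.
End AlgPower.

Definition quot_power (K : fieldType) (A : assocAlgType K) (m : nat) :
    assocAlgType K :=
  quot_alg (@power_ideal K A m).

(* The semigroup algebra K[S], S finite: an element is the family of its
   coordinates in the basis S. *)
Definition sg_alg (K : fieldType) (S : finSemigroup0) : Type := {ffun S -> K^o}.

Section SemigroupAlgebra.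
Variables (K : fieldType) (S : finSemigroup0).
Local Notation KS := (sg_alg K S).

HB.instance Definition _ := GRing.Lmodule.on KS.

Definition sga_mul (f g : KS) : KS :=
  [ffun u => \sum_(p : S * S | (p.1 * p.2)%g == u) (f p.1 : K) * (g p.2 : K)].

Lemma sga_mulE (f g : KS) u :
  sga_mul f g u = \sum_s \sum_(t | (s * t)%g == u) (f s : K) * g t.
Proof. by rewrite ffunE pair_big_dep. Qed.

Fact sga_mulA : associative sga_mul.
Proof.
move=> f g h; apply/ffunP=> u; rewrite !sga_mulE.
transitivity (\sum_s \sum_t \sum_(v | (s * t * v)%g == u)
   (f s : K) * (g t : K) * (h v : K)); last first.
  transitivity (\sum_w \sum_(v | (w * v)%g == u) \sum_s \sum_(t | (s * t)%g == w)
     (f s : K) * (g t : K) * (h v : K)).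
    rewrite [RHS](eq_bigr (fun w => \sum_s \sum_(t | (s * t)%g == w)
       \sum_(v | (w * v)%g == u) (f s : K) * g t * h v)); last first.
      move=> w _; rewrite exchange_big; apply: eq_bigr => s _.
      by rewrite exchange_big.
    rewrite [RHS]exchange_big; apply: eq_bigr => s _ /=.
    rewrite [RHS](exchange_big_dep predT) //=; apply: eq_bigr => t _.
    by rewrite [RHS](big_pred1 (s * t)%g) // => w; rewrite eq_sym.
  apply: eq_bigr => w _; apply: eq_bigr => v _; rewrite sga_mulE mulr_suml.
  by apply: eq_bigr => s _; rewrite mulr_suml.
apply: eq_bigr => s _.
transitivity (\sum_(w | (s * w)%g == u) \sum_t \sum_(v | (t * v)%g == w)
   (f s : K) * (g t : K) * (h v : K)).
  apply: eq_bigr => w _; rewrite sga_mulE mulr_sumr; apply: eq_bigr => t _.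
  by rewrite mulr_sumr; apply: eq_bigr => v _; rewrite mulrA.
rewrite [LHS]exchange_big; apply: eq_bigr => t _ /=.
rewrite [LHS](exchange_big_dep (fun v => (s * t * v)%g == u)) /=; last first.
  by move=> w v /eqP <- /eqP <-; rewrite mulgA.
apply: eq_bigr => v /eqP uE; rewrite [LHS](big_pred1 (t * v)%g) // => w /=.
apply/andP/eqP => [[_ /eqP]//|->]; by rewrite mulgA uE !eqxx.
Qed.

HB.instance Definition _ := isSemigroup.Build KS sga_mulA.

Fact sga_mulDl : left_distributive sga_mul +%R.
Proof.
move=> f g h; apply/ffunP=> u; rewrite !ffunE -big_split.
by apply: eq_bigr => p _; rewrite ffunE mulrDl.
Qed.
Fact sga_mulDr : right_distributive sga_mul +%R.
Proof.
move=> f g h; apply/ffunP=> u; rewrite !ffunE -big_split.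
by apply: eq_bigr => p _; rewrite ffunE mulrDr.
Qed.
Fact sga_mulZl (a : K) (f g : KS) : sga_mul (a *: f) g = a *: sga_mul f g.
Proof.
apply/ffunP=> u; rewrite !ffunE [RHS]mulr_sumr.
by apply: eq_bigr => p _; rewrite ffunE mulrA.
Qed.
Fact sga_mulZr (a : K) (f g : KS) : sga_mul f (a *: g) = a *: sga_mul f g.
Proof.
apply/ffunP=> u; rewrite !ffunE [RHS]mulr_sumr.
by apply: eq_bigr => p _; rewrite ffunE mulrCA.
Qed.

HB.instance Definition _ :=
  isBilinearMul.Build K KS sga_mulDl sga_mulDr sga_mulZl sga_mulZr.

Definition sg_basis (s : S) : KS := [ffun t => (t == s)%:R].

(* The line K z in K[S]. *)
Definition zero_line : {pred KS} :=
  fun f => `[< exists a : K, f = a *: sg_basis szero >].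

Fact zero_line_submod : submod_closed zero_line.
Proof.
split=> [|a u v]; first by apply/asboolP; exists 0; rewrite scale0r.
move=> /asboolP[b ->] /asboolP[c ->]; apply/asboolP; exists (a * b + c).
by rewrite scalerDl scalerA.
Qed.

Fact zero_line_Ml (f g : KS) : g \in zero_line -> (f * g)%g \in zero_line.
Proof.
move=> /asboolP[a ->]; apply/asboolP; exists (a * \sum_s (f s : K)).
apply/ffunP=> u; rewrite [LHS]sga_mulE !ffunE /= /GRing.scale /=.
rewrite -mulrA mulr_suml mulr_sumr.
apply: eq_bigr => s _; rewrite big_mkcond (bigD1 szero) //= big1 => [|t tz].
  rewrite muls0 !ffunE /GRing.scale /= eqxx addr0 eq_sym.
  by case: eqP; rewrite ?mulr1 ?mulr0 // mulrC.
by rewrite !ffunE (negPf tz) /GRing.scale /= !mulr0 if_same.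
Qed.

Fact zero_line_Mr (f g : KS) : f \in zero_line -> (f * g)%g \in zero_line.
Proof.
move=> /asboolP[a ->]; apply/asboolP; exists (a * \sum_s (g s : K)).
apply/ffunP=> u; rewrite [LHS]sga_mulE (bigD1 szero) //= [X in _ + X]big1 => [|t tz].
  rewrite addr0 !ffunE /GRing.scale /= eqxx mulr1 -mulrA mulr_suml mulr_sumr.
  rewrite big_mkcond; apply: eq_bigr => t _.
  by rewrite mul0s eq_sym; case: eqP; rewrite ?mulr1 ?mulr0.
by rewrite big1 // => v _; rewrite !ffunE (negPf tz) /GRing.scale /= mulr0 mul0r.
Qed.

Definition zero_ideal : algIdeal KS :=
  AlgIdeal zero_line_submod zero_line_Ml zero_line_Mr.
End SemigroupAlgebra.

Definition contracted (K : fieldType) (S : finSemigroup0) : assocAlgType K :=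
  quot_alg (zero_ideal K S).

Section PolyIdeal.
Variable K : fieldType.

(* poly_ideal K is I_K, null_alg K is L_K and M1 K is M_{K,1}. *)
Definition const0 : {pred {poly K}} := [pred p : {poly K} | p`_0 == 0].

Fact const0_submod : submod_closed const0.
Proof.
split=> [|a p q]; rewrite !inE ?coef0 // => /eqP p0 /eqP q0.
by rewrite coefD coefZ p0 q0 mulr0 addr0.
Qed.

HB.instance Definition _ :=
  GRing.isSubmodClosed.Build K {poly K} const0 const0_submod.

Record poly_ideal := PolyIdeal {
  poly_ideal_val : {poly K};
  _ : poly_ideal_val \in const0
}.

HB.instance Definition _ := [isSub for poly_ideal_val].
HB.instance Definition _ := [Choice of poly_ideal by <:].
HB.instance Definition _ := [SubChoice_isSubLmodule of poly_ideal by <:].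

Fact poly_ideal_mul_subproof (p q : poly_ideal) : val p * val q \in const0.
Proof. by have := valP p; rewrite !inE coef0M => /eqP ->; rewrite mul0r. Qed.

Definition poly_ideal_mul (p q : poly_ideal) : poly_ideal :=
  PolyIdeal (poly_ideal_mul_subproof p q).

Fact poly_ideal_mulA : associative poly_ideal_mul.
Proof. by move=> p q r; apply/val_inj; rewrite /= mulrA. Qed.

HB.instance Definition _ := isSemigroup.Build poly_ideal poly_ideal_mulA.

Fact poly_ideal_mulDl : left_distributive poly_ideal_mul +%R.
Proof. by move=> p q r; apply/val_inj; rewrite /= mulrDl. Qed.
Fact poly_ideal_mulDr : right_distributive poly_ideal_mul +%R.
Proof. by move=> p q r; apply/val_inj; rewrite /= mulrDr. Qed.
Fact poly_ideal_mulZl (a : K) (p q : poly_ideal) :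
  poly_ideal_mul (a *: p) q = a *: poly_ideal_mul p q.
Proof. by apply/val_inj; rewrite /= scalerAl. Qed.
Fact poly_ideal_mulZr (a : K) (p q : poly_ideal) :
  poly_ideal_mul p (a *: q) = a *: poly_ideal_mul p q.
Proof. by apply/val_inj; rewrite /= scalerAr. Qed.

HB.instance Definition _ :=
  isBilinearMul.Build K poly_ideal poly_ideal_mulDl poly_ideal_mulDr
    poly_ideal_mulZl poly_ideal_mulZr.
End PolyIdeal.

Definition null_alg (K : fieldType) : Type := K^o.

Section NullAlg.
Variable K : fieldType.
Local Notation L := (null_alg K).

HB.instance Definition _ := GRing.Lmodule.on L.

Definition null_mul (x y : L) : L := 0.

Fact null_mulA : associative null_mul. Proof. by []. Qed.
HB.instance Definition _ := isSemigroup.Build L null_mulA.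

Fact null_mulDl : left_distributive null_mul +%R.
Proof. by move=> x y z; rewrite addr0. Qed.
Fact null_mulDr : right_distributive null_mul +%R.
Proof. by move=> x y z; rewrite addr0. Qed.
Fact null_mulZl (a : K) (x y : L) : null_mul (a *: x) y = a *: null_mul x y.
Proof. by rewrite scaler0. Qed.
Fact null_mulZr (a : K) (x y : L) : null_mul x (a *: y) = a *: null_mul x y.
Proof. by rewrite scaler0. Qed.

HB.instance Definition _ :=
  isBilinearMul.Build K L null_mulDl null_mulDr null_mulZl null_mulZr.
End NullAlg.

Section DirectSum.
Variables (K : fieldType) (A B : assocAlgType K).
Local Notation AB := (A * B)%type.

Fact pair_amulDl : left_distributive (@monoid.mul AB) +%R.
Proof. by move=> x y z; congr pair; rewrite amulDl. Qed.
Fact pair_amulDr : right_distributive (@monoid.mul AB) +%R.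
Proof. by move=> x y z; congr pair; rewrite amulDr. Qed.
Fact pair_amulZl (a : K) (x y : AB) : ((a *: x) * y)%g = a *: (x * y)%g.
Proof. by congr pair; rewrite amulZl. Qed.
Fact pair_amulZr (a : K) (x y : AB) : (x * (a *: y))%g = a *: (x * y)%g.
Proof. by congr pair; rewrite amulZr. Qed.

HB.instance Definition _ :=
  isBilinearMul.Build K AB pair_amulDl pair_amulDr pair_amulZl pair_amulZr.
End DirectSum.

Definition M1 (K : fieldType) : assocAlgType K := (poly_ideal K * null_alg K)%type.

Definition KZ (K : fieldType) (n : nat) : algtype K :=
  isotype (contracted K (zero_semigroup n)).
Arguments KZ : clear implicits.

Definition exactly (T : Type) (n : nat) (P : T -> Prop) : Prop :=
  exists e : 'I_n -> T,
    (forall i j, e i = e j -> i = j) /\ (forall x, P x <-> exists i, x = e i).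

Section CoclassGraph.
Variables (K : fieldType) (r : nat).
Implicit Types A B C : algtype K.

Definition vertex A : Prop :=
  exists2 S : finSemigroup0, has_coclass S r & A = isotype (contracted K S).

(* A -> B, with A the parent of B; b is an algebra of type B. *)
Definition edge A B : Prop :=
  [/\ vertex A, vertex B &
      exists (b : assocAlgType K) (c : nat),
        [/\ B b, has_class (0 : b) c & A (quot_power b c)]].

Definition label A (n : nat) : Prop :=
  exactly n (fun X : sgtype => exists S : finSemigroup0,
    [/\ has_coclass S r, A (contracted K S) & X = sg_isotype S]).

Definition is_root A : Prop := vertex A /\ forall B, ~ edge B A.

Definition subtree A : algtype K -> Prop := clos_refl_trans _ edge A.

Definition infinite_path (P : nat -> algtype K) : Prop :=
  forall i, edge (P i) (P i.+1).

Definition maximal_infinite_path (P : nat -> algtype K) : Prop :=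
  infinite_path P /\ is_root (P 0%N).

Definition coclass_tree A : Prop :=
  vertex A /\ exists! P, infinite_path P /\ P 0%N = A.

Definition maximal_coclass_tree A : Prop :=
  coclass_tree A /\
  (is_root A \/
   exists B, edge B A /\
     exists P Q, [/\ maximal_infinite_path P, maximal_infinite_path Q, P <> Q,
                     exists i, P i = B & exists j, Q j = B]).

Definition tree_iso A B (mu : algtype K -> algtype K) : Prop :=
  [/\ forall C, subtree A C -> subtree B (mu C),
      forall C D, subtree A C -> subtree A D -> mu C = mu D -> C = D,
      forall D, subtree B D -> exists2 C, subtree A C & mu C = D &
      forall C D, subtree A C -> subtree A D -> (edge C D <-> edge (mu C) (mu D))].

Definition in_diff A B C : Prop := subtree A C /\ ~ subtree B C.

(* The tree isomorphism mu and the polynomials f B witness that the maximal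
   coclass tree T(P 0) with maximal infinite path A_1 -> A_2 -> ..., where
   A_j = P j.-1, is strongly virtually periodic with strong defect l and
   strong period k. *)
Definition strongly_virtually_periodic_with (P : nat -> algtype K) (l k : nat)
    (mu : algtype K -> algtype K) (f : algtype K -> {poly rat}) : Prop :=
  [/\ maximal_coclass_tree (P 0%N), infinite_path P, (0 < l)%N /\ (0 < k)%N,
      tree_iso (P l.-1) (P (l + k).-1) mu &
      forall B, in_diff (P l.-1) (P (l + k).-1) B ->
        forall i : nat, exists2 n, label (iter i mu B) n & (f B).[i%:R] = n%:R].

(* M / M^(j + c) is of type A_j = P j.-1, where c is the class of A_1. *)
Definition describes (M : assocAlgType K) (P : nat -> algtype K) : Prop :=
  infinite_dimensional M /\
  exists (a : assocAlgType K) (c : nat),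
    [/\ P 0%N a, has_class (0 : a) c &
        forall j, (0 < j)%N -> P j.-1 (quot_power M (j + c))].
End CoclassGraph.

(* Main.v *)
From HB Require Import structures.
From Stdlib Require Import Relation_Operators.
Require Import Defs.
From mathcomp Require Import all_boot all_algebra.
From mathcomp Require Import generic_quotient ring_quotient boolp.
From mathcomp Require Import zify ring.

Set Implicit Arguments.
Unset Strict Implicit.
Unset Printing Implicit Defensive.

Import GRing.Theory.

Local Open Scope ring_scope.

(** Let S be a nilpotent semigroup of class c and coclass one, so that it has
    c + 1 non-zero elements. The c prefixes of a non-zero product of c elements
    are distinct and not zero, hence only one further non-zero element is left
    over. For c > 2 this forces S to contain an element a with a^c <> 0
    ([cyclic_generator]), and then S = {a, ..., a^c, b, 0} is determined by the
    exponents in ab = a^(p+1), ba = a^(q+1) and b^2 = a^k ([iso_model]).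
    Associativity leaves two possibilities: p = q, with k = 2p or with both 2p
    and k at least c; or {p, q} = {c - 1, c} and k at least c. For c > 2 these
    parameters are isomorphism invariants ([model_inj]), so semigroups are
    counted by counting triples (p, q, k).

    In the contracted algebra b may be replaced by b - a^p, respectively by b
    or a^(c-1) - b. The new b satisfies ba = 0, and both ab and b^2 are
    multiples of the last power a^c ([pres_model]). Up to isomorphism at most five
    algebras remain in each class above 2: M_{K,1} modulo its (c+1)st power, the
    commutative algebras with b^2 = a^c and b^2 = - a^c, and two noncommutative
    ones, with ab = a^c and with b^2 equal to 0 or to a^c. The relation
    b^2 = - a^c comes only from 2p = c and k = c + 1, hence only from an even
    c. Commutativity distinguishes some of the five. For the rest,
    presentations with squares g a^c and g' a^c of the same algebra satisfy
    g y^2 = g' x^c for suitable scalars x <> 0 and y ([pres_square]), so that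
    b^2 = a^c and b^2 = - a^c are separated for even c exactly when -1 is not a
    square.

    The relations of these algebras differ only in the last power, so that each
    one of class c + 1 has M_{K,1} modulo its (c+1)st power as its parent
    ([edgeP]). This also holds for class 2: modulo its square every algebra of
    class 2 is spanned by its two generators. The graph is therefore one path
    with leaves attached, and it repeats with period 2 because admissibility of
    the five kinds depends only on the parity of c. Among the triples
    (p, q, k) the algebra on the path takes those with k = min(2p, c + 1), which
    are c many; b^2 = a^c takes those with p = q, 2p > c and k = c; every other
    kind takes at most two. All these numbers are linear in c along a fixed
    parity ([label_linear]). *)

(** * Quotients and isomorphisms of algebras *)

Section QuotientMap.
Variables (K : fieldType) (A : assocAlgType K) (I : algIdeal A).

(** The canonical projection, typed as a map into the quotient algebra so that its
    linear structure can be declared. *)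
Definition qpi (x : A) : quot_alg I :=
  (\pi_(Quotient.quot (ideal_pred I)) x)%qT.

Lemma qpi_eq x y : qpi x = qpi y <-> x - y \in I.
Proof. by rewrite Quotient.idealrBE; split => [/eqP|/eqP]. Qed.

Lemma qpi_surj (u : quot_alg I) : exists x, u = qpi x.
Proof.
exists (repr (u : Quotient.quot (ideal_pred I))).
by rewrite /qpi reprK.
Qed.

Lemma qpi_repr x : repr (qpi x : Quotient.quot (ideal_pred I)) - x \in I.
Proof. by apply/qpi_eq; rewrite /qpi reprK. Qed.

Fact qpi_is_linear : linear qpi.
Proof.
move=> a x y; have -> : a *: qpi x = qpi (a *: x).
  by apply/qpi_eq; rewrite -scalerBr rpredZ // qpi_repr.
by rewrite /qpi raddfD.
Qed.

HB.instance Definition _ :=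
  GRing.isLinear.Build K A (quot_alg I) *:%R qpi qpi_is_linear.

Lemma qpiZ a x : qpi (a *: x) = a *: qpi x.
Proof. exact: linearZ. Qed.

Lemma qpiM x y : qpi (x * y)%g = (qpi x * qpi y)%g.
Proof.
apply/esym/qpi_eq.
set u := repr (qpi x : Quotient.quot (ideal_pred I)).
set v := repr (qpi y : Quotient.quot (ideal_pred I)).
have -> : (u * v)%g - (x * y)%g = ((u - x) * v)%g + (x * (v - y))%g.
  rewrite amulDl amulDr -addrA; congr (_ + _).
  by rewrite addrA -amulDl addNr amul0l add0r amulNr.
by apply: rpredD; [apply: Defs.idealMr | apply: Defs.idealMl]; apply: qpi_repr.
Qed.

Lemma qpi_eq0 x : qpi x = 0 <-> x \in I.
Proof. by rewrite -[0](raddf0 qpi) -[X in X \in I]subr0; apply: qpi_eq. Qed.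

End QuotientMap.

Lemma alg_iso_refl (K : fieldType) (A : assocAlgType K) : alg_iso A A.
Proof.
pose f : {linear A -> A} := idfun.
by exists f => //; exists idfun.
Qed.

(** Two algebras covered by the same vector space, with the same kernel and
    the same (not necessarily associative) multiplication upstairs, are both
    the quotient of that space by that kernel. *)
Lemma alg_iso_of_covers (K : fieldType) (F : lmodType K) (m : F -> F -> F)
    (A B : assocAlgType K) (E : {linear F -> A}) (E' : {linear F -> B}) :
  (forall x, exists u, x = E u) -> (forall y, exists v, y = E' v) ->
  (forall u, E u = 0 <-> E' u = 0) ->
  (forall u v, (E u * E v)%g = E (m u v)) ->
  (forall u v, (E' u * E' v)%g = E' (m u v)) ->
  alg_iso A B.
Proof.
move=> Es E's ker Em E'm.
have [s sE] := choice Es; have [s' s'E] := choice E's.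
have kE u v : E u = E v <-> E' u = E' v.
  have D (T : lmodType K) (G : {linear F -> T}) : G u = G v <-> G (u - v) = 0.
    rewrite raddfB; split=> [e|/eqP]; first by apply/eqP; rewrite subr_eq0; apply/eqP.
    by rewrite subr_eq0 => /eqP.
  by split=> /D e; apply/D; apply/ker.
pose f x := E' (s x).
have fE u : f (E u) = E' u by apply/kE; rewrite -sE.
have f_lin : linear f.
  by move=> a x y; rewrite {1}(sE x) {1}(sE y) -linearP fE linearP.
pose F0 : {linear A -> B} := HB.pack f (GRing.isLinear.Build K A B *:%R f f_lin).
exists F0.
  exists (E \o s') => [x|y] /=; first by rewrite (sE x) /F0 /= fE; apply/kE;
    rewrite -s'E.
  by rewrite /F0 /= fE -s'E.
by move=> x y; rewrite /F0 /= (sE x) (sE y) Em !fE E'm.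
Qed.

Lemma alg_iso_sym (K : fieldType) (A B : assocAlgType K) :
  alg_iso A B -> alg_iso B A.
Proof.
case=> f [g fK gK] fM; pose i : {linear A -> A} := idfun.
apply: (@alg_iso_of_covers K A (fun x y => x * y)%g B A f i) => //.
- by move=> x; exists (g x); rewrite gK.
- by move=> x; exists x.
- move=> u; split=> /= [u0|->]; last by rewrite raddf0.
  by apply: (can_inj fK); rewrite u0 raddf0.
Qed.

Lemma alg_iso_trans (K : fieldType) (A B C : assocAlgType K) :
  alg_iso A B -> alg_iso B C -> alg_iso A C.
Proof.
case=> f fb fM [g gb gM]; pose h : {linear A -> C} := g \o f.
exists h; first exact: bij_comp.
by move=> x y; rewrite /h /= fM gM.
Qed.

Lemma isotype_eq (K : fieldType) (A B : assocAlgType K) :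
  alg_iso A B -> isotype A = isotype B.
Proof.
move=> AB; apply/funext=> C; apply/propext; split; last exact: alg_iso_trans.
exact/alg_iso_trans/alg_iso_sym.
Qed.

(** * Classes *)

Lemma has_class_uniq (S : semigroupType) (z : S) c d :
  has_class z c -> has_class z d -> c = d.
Proof.
by move=> [vertex_of_class mc] [vd md]; apply/eqP; rewrite eqn_leq mc // md.
Qed.

Lemma vanishing_leq (S : semigroupType) (z : S) c d :
  left_zero z (@monoid.mul S) -> (c <= d)%N -> vanishing z c -> vanishing z d.
Proof.
move=> z0 cd vz x s sd; rewrite -(cat_take_drop c s) /lprod foldl_cat.
rewrite -[foldl _ x _]/(lprod x _) vz; last by rewrite size_takel // sd.
by elim: (drop c s) => //= y t IH; rewrite z0.
Qed.

Arguments lprod : simpl never.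

Lemma lprod_morph (S T : semigroupType) (f : S -> T) x s :
  {morph f : x y / (x * y)%g} -> f (lprod x s) = lprod (f x) (map f s).
Proof. by move=> fM; rewrite /lprod; elim: s x => //= y s IH x; rewrite IH fM. Qed.

Lemma lprod_mull (S : semigroupType) (x y : S) s :
  lprod (x * y)%g s = (x * lprod y s)%g.
Proof. by rewrite /lprod; elim: s y => //= z s IH y; rewrite -mulgA IH. Qed.

Lemma lprod_cat (S : semigroupType) (x : S) s t :
  lprod x (s ++ t) = lprod (lprod x s) t.
Proof. exact: foldl_cat. Qed.

Lemma lprod_cons (S : semigroupType) (x y : S) s :
  lprod x (y :: s) = (x * lprod y s)%g.
Proof. by rewrite -lprod_mull. Qed.

Lemma lprod_rcons (S : semigroupType) (x y : S) s :
  lprod x (rcons s y) = (lprod x s * y)%g.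
Proof. by rewrite -cats1 lprod_cat. Qed.

(** The power x^(n + 1); a semigroup has no unit to start from. *)
Definition spow (S : semigroupType) (x : S) (n : nat) : S := iter n (@monoid.mul S x) x.

Lemma spow_lprod (S : semigroupType) (x : S) n : spow x n = lprod x (nseq n x).
Proof. by elim: n => //= n IH; rewrite lprod_cons -IH. Qed.

Lemma spowD (S : semigroupType) (x : S) m n :
  (spow x m * spow x n)%g = spow x (m + n).+1.
Proof. by elim: m => //= m IH; rewrite -mulgA IH. Qed.

Lemma iso_vanishing (S T : semigroupType) (z : S) (f : S -> T) d :
  bijective f -> {morph f : x y / (x * y)%g} ->
  vanishing z d -> vanishing (f z) d.
Proof.
move=> [g fK gK] fM vz x s sd.
rewrite -(gK x) -[s](mapK gK) -lprod_morph // vz //.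
by rewrite size_map.
Qed.

Lemma iso_has_class (S T : semigroupType) (z : S) (f : S -> T) d :
  bijective f -> {morph f : x y / (x * y)%g} ->
  has_class z d -> has_class (f z) d.
Proof.
move=> fb fM [vz mz]; split=> [|e ve]; first exact: iso_vanishing.
apply: mz; case: fb => g fK gK.
rewrite -[z]fK; apply: iso_vanishing ve; first by exists f.
by move=> x y; apply: (can_inj fK); rewrite fM !gK.
Qed.

Lemma alg_iso_class (K : fieldType) (A B : assocAlgType K) c :
  alg_iso A B -> has_class (0 : A) c -> has_class (0 : B) c.
Proof.
by case=> f fb fM /(iso_has_class fb fM); rewrite raddf0.
Qed.
(** * Presentations with two generators *)

(** The relations on the generators a and b in class c, always with ba = 0: [Main]
    is ab = b^2 = 0, [SqP] and [SqM] are ab = 0 with b^2 = a^c and b^2 = - a^c,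
    [Nc0] and [Nc1] are ab = a^c with b^2 = 0 and b^2 = a^c. *)
Variant kind := Main | SqP | SqM | Nc0 | Nc1.

Definition kind_code (t : kind) : nat :=
  match t with Main => 0 | SqP => 1 | SqM => 2 | Nc0 => 3 | Nc1 => 4 end.

Fact kind_code_inj : injective kind_code. Proof. by do 2!case. Qed.

HB.instance Definition _ := Equality.copy kind (inj_type kind_code_inj).

Section Presentations.
Variable K : fieldType.
Local Notation F := ({poly K} * K^o)%type.

Definition noncomm (t : kind) : K := (t \in [:: Nc0; Nc1])%:R.
Definition square (t : kind) : K :=
  match t with SqP | Nc1 => 1 | SqM => -1 | _ => 0 end.

Definition twist (t : kind) (u v : F) : K :=
  noncomm t * u.1`_0 * v.2 + square t * u.2 * v.2.

(** The pair (P, d) stands for P(a) a + d b. Shifting the polynomial by one degree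
    makes up for the missing unit and leaves all of {poly K} as parameter space; the
    product of two pairs is computed before any power of a is set to zero. *)
Definition pmul (c : nat) (t : kind) (u v : F) : F :=
  ('X * u.1 * v.1 + twist t u v *: 'X^(c.-1), 0).

(** The map alone, without a condition on its kernel, already determines the powers
    of the algebra. It serves for infinite dimensional algebras as well. *)
Definition covers (c : nat) (t : kind) (B : assocAlgType K)
    (E : {linear F -> B}) : Prop :=
  (forall x, exists u, x = E u) /\
  (forall u v, (E u * E v)%g = E (pmul c t u v)).

Definition low (c : nat) (p : {poly K}) : Prop :=
  forall i, (i < c)%N -> p`_i = 0.

(** The isomorphism type of the algebra with basis a, ..., a^c, b, where a^(c+1) = 0
    and the other relations are those of the kind t. See [isotype_pres]. *)
Definition pres (c : nat) (t : kind) : algtype K := fun B =>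
  exists2 E : {linear F -> B}, covers c t E &
    forall u, E u = 0 <-> low c u.1 /\ u.2 = 0.

Lemma lowP c p : low c p <-> exists q, p = 'X^c * q.
Proof.
split=> [p0|[q ->] i ic]; last by rewrite mulrC coefMXn ic.
exists (drop_poly c p); rewrite mulrC -[LHS](poly_take_drop c).
suff -> : take_poly c p = 0 by rewrite add0r.
by apply/polyP=> i; rewrite coef_take_poly coef0; case: ifP => // /p0.
Qed.

Lemma twist_main u v : twist Main u v = 0.
Proof. by rewrite /twist /noncomm !mul0r addr0. Qed.

Lemma twist_l0 t (p : {poly K}) v : p`_0 = 0 -> twist t (p, 0) v = 0.
Proof. by move=> p0; rewrite /twist /= p0 mulr0 !mul0r mulr0 mul0r addr0. Qed.

Lemma twist_r0 t u (p : {poly K}) : twist t u (p, 0) = 0.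
Proof. by rewrite /twist /= !mulr0 addr0. Qed.

Lemma pres_iso c t (B C : assocAlgType K) :
  alg_iso B C -> pres c t B -> pres c t C.
Proof.
case=> f fb fM [E [Es Em] ker]; pose E' : {linear F -> C} := f \o E.
have [g fK gK] := fb; exists E'; first split=> [x|u v].
- by have [u e] := Es (g x); exists u; rewrite /E' /= -e gK.
- by rewrite /E' /= -fM Em.
- move=> u; rewrite -ker /E' /=; split=> [e|->]; last by rewrite raddf0.
  by apply: (can_inj fK); rewrite e raddf0.
Qed.

Lemma pres_unique c t (B C : assocAlgType K) :
  pres c t B -> pres c t C -> alg_iso B C.
Proof.
move=> [E [Es Em] ker] [E' [E's E'm] ker'].
apply: (alg_iso_of_covers Es E's _ Em E'm) => u.
by rewrite ker ker'.
Qed.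

Lemma isotype_pres c t (B : assocAlgType K) : pres c t B -> isotype B = pres c t.
Proof.
move=> pB; apply/funext=> C; apply/propext.
by split; [move/pres_iso; apply | apply: pres_unique].
Qed.

Section Cover.
Variables (c : nat) (t : kind) (B : assocAlgType K) (E : {linear F -> B}).
Hypothesis Ec : covers c t E.
Hypothesis ok : (1 < c)%N || (t == Main).

Lemma coverXM (p : {poly K}) v : (E ('X * p, 0)%R * E v)%g = E ('X * ('X * p) * v.1, 0).
Proof.
by rewrite Ec.2 /pmul twist_l0 ?scale0r ?addr0 // mulrC coefMX.
Qed.

Lemma coverMX u (p : {poly K}) : (E u * E (p, 0))%g = E ('X * u.1 * p, 0).
Proof. by rewrite Ec.2 /pmul twist_r0 scale0r addr0. Qed.

(** Each further factor contributes one more power of X. For the second factor the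
    correction [twist] X^(c-1) has to be divisible by X itself, whence the hypothesis
    on c; from the third factor on there is no correction, because one of the two
    arguments of [twist] then has no constant coefficient and no component at b. *)
Lemma cover_prod x s : s <> [::] ->
  exists p, lprod x s = E ('X^(size s) * p, 0).
Proof.
have [Es Em] := Ec; elim/last_ind: s => // s y IH _.
have [v ->] := Es y; rewrite lprod_rcons size_rcons.
have [->|/eqP s0] := eqVneq s [::]; last first.
  have [p ->] := IH s0; exists (p * v.1).
  case: (size s) (size_eq0 s) => [|k _]; first by case: (s) s0.
  by rewrite [in LHS]exprS -mulrA coverXM !mulrA -expr2 -exprD.
have [u ->] := Es x; rewrite /= Em /pmul.
case/orP: ok => [c1|/eqP ->]; last first.
  by exists (u.1 * v.1); rewrite twist_main scale0r addr0 expr1 mulrA.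
exists (u.1 * v.1 + twist t u v *: 'X^(c.-2)).
rewrite expr1 mulrDr mulrA -scalerAr -exprS; congr (E (_ + _ *: 'X^_, _)).
by case: (c) c1 => // -[].
Qed.

Lemma cover_monomial p k :
  exists y s, size s = k /\ lprod y s = E ('X^k * p, 0).
Proof.
elim: k => [|k [y [s [sk e]]]]; first by exists (E (p, 0)), [::]; rewrite expr0 mul1r.
exists (E (1, 0)), (y :: s); split; first by rewrite /= sk.
by rewrite lprod_cons e coverMX mulr1 exprS mulrA.
Qed.

(** Products of m elements are divisible by X^(m-1), and conversely X^(m-1) P is
    itself the product of m - 1 copies of a with P(a) a. *)
Lemma cover_power m x : (1 < m)%N ->
  x \in power_ideal B m <-> exists p, x = E ('X^(m.-1) * p, 0).
Proof.
move=> m1; split; last first.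
  move=> [p ->]; have [y [s [sm e]]] := cover_monomial p m.-1.
  apply/asboolP; exists [:: (1, lprod y s)]; rewrite big_seq1 scale1r e.
  by split=> // q; rewrite inE => /eqP -> /=; exists y, s.
move/asboolP=> [s [sP ->]]; elim: s sP => [|q s IH] sP.
  by exists 0; rewrite big_nil mulr0 -[(0, 0)]/(0 : F) raddf0.
have [|p pE] := IH; first by move=> r rs; apply: sP; rewrite inE rs orbT.
rewrite big_cons pE; have [|y [r [rm ->]]] := sP q; first by rewrite inE eqxx.
have [|p' ->] := @cover_prod y r; first by move=> e; move: rm; rewrite e /=; lia.
exists (q.1 *: p' + p); rewrite rm -linearZ -raddfD; congr (E _).
by congr pair; rewrite /= ?addr0 ?scaler0 // mulrDr scalerAr.
Qed.

(** Modulo the m-th power the correction of the multiplication disappears, which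
    leaves the algebra on the infinite path. The kernel condition covers at once
    M_{K,1}, where the kernel is zero, and the finite dimensional algebras. *)
Lemma quot_cover m : (1 < m)%N -> (m <= c)%N || (t == Main) ->
  (forall u, E u = 0 -> low m.-1 u.1 /\ u.2 = 0) ->
  pres m.-1 Main (quot_power B m).
Proof.
move=> m1 mc ker; pose p : {linear B -> quot_power B m} := @qpi K B (power_ideal B m).
pose E' : {linear F -> quot_power B m} := p \o E.
exists E'; first split=> [x|u v].
- have [y ->] := qpi_surj x; have [u ->] := Ec.1 y; by exists u.
- rewrite /E' /= /p /= -qpiM Ec.2; apply/qpi_eq; rewrite -raddfB.
  apply/(cover_power _ m1); rewrite /pmul twist_main scale0r addr0.
  case/orP: mc => [mc|/eqP tE]; last first.
    exists 0; rewrite tE twist_main scale0r addr0 mulr0; congr (E _).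
    by congr pair => /=; rewrite subrr.
  exists (twist t u v *: 'X^(c - m)); congr (E _); congr pair => /=;
    last by rewrite subrr.
  rewrite addrC addKr -scalerAr -exprD; congr (_ *: 'X^_); lia.
- move=> u; rewrite /E' /= /p /= qpi_eq0 (cover_power _ m1); split.
  + move=> [q e]; have [] := ker (u - ('X^(m.-1) * q, 0)).
      by rewrite raddfB /= e subrr.
    rewrite /= subr0 => l ->; split=> // i im.
    by move: (l i im); rewrite coefB (mulrC _ q) coefMXn im subr0.
  + case: u => u1 u2 [/lowP[q /= ->] /= ->]; by exists q.
Qed.

End Cover.

Lemma pres_class c t (B : assocAlgType K) : (1 < c)%N || (t == Main) && (0 < c)%N ->
  pres c t B -> has_class (0 : B) c.
Proof.
move=> c0 [E Ec ker].
have ok : (1 < c)%N || (t == Main) by case/orP: c0 => [->//|/andP[->]]; rewrite orbT.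
have {}c0 : (0 < c)%N by case/orP: c0 => [/ltnW//|/andP[]].
split=> [x s sc|d vd].
  have [|p ->] := cover_prod Ec ok x (s := s); first by move=> e; rewrite -sc e in c0.
  by apply/ker; split=> //; apply/lowP; exists p; rewrite sc.
rewrite leqNgt; apply/negP=> dc.
have [y [s [sd e]]] := cover_monomial Ec 1 d.
have /ker [] : E ('X^d * 1, 0) = 0 by rewrite -e vd.
by move=> /(_ _ dc) /eqP; rewrite /= mulr1 coefXn eqxx oner_eq0.
Qed.

Lemma pres_quot c t (B : assocAlgType K) : (1 < c)%N ->
  pres c t B -> pres c.-1 Main (quot_power B c).
Proof.
move=> c1 [E Ec ker]; apply: (quot_cover Ec) => //; rewrite ?c1 ?leqnn //.
by move=> u /ker[l ->]; split=> // i ic; apply: l; apply: leq_trans ic (leq_pred _).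
Qed.

End Presentations.
(** * Isomorphisms between presented algebras *)

Section Invariants.
Variable K : fieldType.
Local Notation F := ({poly K} * K^o)%type.

(** If -1 = i^2 then replacing b by i b exchanges [SqP] and [SqM]; the
    representative of the two is [SqP]. *)
Definition canon (t : kind) : kind :=
  if `[< exists i : K, i ^+ 2 = -1 >] && (t == SqM) then SqP else t.

(** The generator b is replaced by a non-zero multiple. *)
Lemma pres_rescale c t t' (i : K) (B : assocAlgType K) : i != 0 ->
  noncomm K t = 0 -> noncomm K t' = 0 -> square K t' = square K t * i ^+ 2 ->
  pres c t B -> pres c t' B.
Proof.
move=> i0 nt nt' sq [E [Es Em] ker].
(* The parameters (P, i d) give P(a) a + d (i b). *)
pose r (u : F) : F := (u.1, i * u.2).
have r_lin : linear r.
  by move=> a u v; congr pair; rewrite /= mulrDr; congr (_ + _); apply: mulrCA.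
pose R : {linear F -> F} := HB.pack r (GRing.isLinear.Build K F F *:%R r r_lin).
pose E' : {linear F -> B} := E \o R.
exists E'; first split=> [x|u v].
- have [[p d] ->] := Es x; exists (p, i^-1 * d).
  by rewrite /E' /R /= /r /= mulrA mulfV // mul1r.
- rewrite /E' /R /= Em /pmul /r /= /twist nt nt' sq /= mulr0 !mul0r !add0r.
  by congr (E (_ + _ *: _, _)); ring.
- move=> u; rewrite /E' /R /= ker /r /=; split=> -[l].
    by move/eqP; rewrite mulf_eq0 (negPf i0) => /eqP.
  by move=> ->; rewrite mulr0.
Qed.

Lemma pres_canon c t : pres c (canon t) = pres (K := K) c t.
Proof.
rewrite /canon; case: asboolP => [[i i2]|//] /=; case: eqP => // ->.
have i0 : i != 0 by rewrite -sqrf_eq0 i2 oppr_eq0 oner_eq0.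
apply/funext=> B; apply/propext; split; apply: (pres_rescale i0) => //.
  by rewrite i2 mul1r.
by rewrite i2 mulrNN mulr1.
Qed.

Lemma pres_comm c t (B : assocAlgType K) : (1 < c)%N -> pres c t B ->
  (forall x y : B, (x * y)%g = (y * x)%g) <-> (t \notin [:: Nc0; Nc1]).
Proof.
move=> c1 [E [Es Em] ker]; split; last first.
  move=> nt x y; have [u ->] := Es x; have [v ->] := Es y; rewrite !Em /pmul.
  rewrite /twist /noncomm (negPf nt) !mul0r; congr (E (_ + _ *: _, _)); ring.
move/(_ (E (1, 0)) (E (0, 1))); rewrite !Em /pmul /twist /= => e.
apply/negP=> nt.
have /ker [/(_ c.-1)] : E ('X^(c.-1), 0) = 0; last first.
  move=> h _; have /eqP := h ltac:(lia).
  by rewrite coefXn eqxx oner_eq0.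
move: e; rewrite /noncomm nt !(coef0, coef1, mulr0, mul0r, mulr1, add0r).
by rewrite addr0 scale1r scale0r => ->; apply: raddf0.
Qed.

Lemma low_mulr n (p q : {poly K}) : q`_0 != 0 -> low n (p * q) -> low n p.
Proof.
move=> q0 pq; elim/ltn_ind=> i IH ilt; have := pq i ilt.
rewrite coefM big_ord_recr /= subnn big1 ?add0r => [|j _].
  by move/eqP; rewrite mulf_eq0 (negPf q0) orbF => /eqP.
by rewrite IH ?mul0r // (ltn_trans _ ilt).
Qed.

(** Let a', b' be the generators of the second presentation. Since b' A^2 = 0, the
    element b' is a multiple y b up to A^(c-1), so that b'^2 = y^2 b^2. As a' is x a
    up to a multiple of b and up to A^2, one has a'^c = x^c a^c. *)
Lemma pres_square c t t' (B : assocAlgType K) : (2 < c)%N ->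
  pres c t B -> pres c t' B ->
  exists x y : K, x != 0 /\ square K t * y ^+ 2 = square K t' * x ^+ c.
Proof.
move=> c2 [E Ec ker] [E' Ec' ker']; have [Es Em] := Ec.
have [[P z] uE] := Es (E' (1, 0)); have [[Q y] vE] := Es (E' (0, 1)).
(* a'^(n+2) = x^(n+2) a^(n+2) up to higher powers of a, where x = P_0. *)
have pow n : exists R : {poly K},
    E' ('X^(n.+1), 0) = E ('X^(n.+1) * (P ^+ n.+2 + 'X * R), 0).
  elim: n => [|n [R e]].
    exists (twist t (P, z) (P, z) *: 'X^(c - 3)).
    rewrite expr1; have := coverMX Ec' (1, 0) 1; rewrite /= !mulr1 => <-.
    rewrite uE Em /pmul /= mulrDr -scalerAr -exprS -scalerAr -exprS -mulrA -expr2.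
    by congr (E (_ + _ *: 'X^_, 0)); lia.
  exists (P * R).
  have := coverMX Ec' (1, 0) 'X^(n.+1); rewrite mulr1 -exprS => <-.
  rewrite uE e (coverMX Ec) /=; congr (E (_, 0)).
  by rewrite [in RHS]exprS [in X in _ = _ * (X + _)]exprS; ring.
exists P`_0, y.
have top (p : {poly K}) : E ('X^(c.-1) * p, 0) = E (p`_0 *: 'X^(c.-1), 0).
  apply/eqP; rewrite -subr_eq0 -raddfB; apply/eqP/ker; split; last exact: subr0.
  move=> i ic; rewrite coefB coefZ coefXn mulrC coefMXn.
  have [lt|gt|->] := ltngtP i c.-1; rewrite ?mulr0 ?subr0 //; first by exfalso; lia.
  by rewrite subnn mulr1 subrr.
have powc : E' ('X^(c.-1), 0) = E (P`_0 ^+ c *: 'X^(c.-1), 0).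
  case: c c2 pow top {ker ker' Em Es Ec Ec'} => [|[|c]] // _ pow top.
  by have [R ->] := pow c; rewrite top coefD coefXM addr0 -horner_coef0 horner_exp
    horner_coef0.
have x0 : P`_0 != 0.
  apply/eqP=> x0; have /ker' [/(_ c.-1)] : E' ('X^(c.-1), 0) = 0.
    rewrite powc x0 expr0n; case: (c) c2 => //= ? _.
    by rewrite scale0r; apply: raddf0.
  by move=> h _; have /eqP := h ltac:(lia); rewrite coefXn eqxx oner_eq0.
split=> //.
(* This expresses b' a'^2 = 0, as a'^2 is x^2 a^2 up to higher powers of a. *)
have Qlow : low (c - 2) Q.
  have [R] := pow 0%N; rewrite expr1 => eX.
  have : (E' (0, 1%R) * E' ('X, 0))%g = 0.
    by rewrite (coverMX Ec') /= mulr0 mul0r; apply: raddf0.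
  rewrite vE eX (coverMX Ec) /= => /ker[/= l _].
  apply: (@low_mulr _ _ (P ^+ 2 + 'X * R)).
    by rewrite coefD coefXM addr0 -horner_coef0 horner_exp expf_neq0 // horner_coef0.
  move=> i ic; have := l i.+2 ltac:(lia).
  have -> : 'X * Q * ('X * (P ^+ 2 + 'X * R)) = 'X^2 * (Q * (P ^+ 2 + 'X * R)) by ring.
  by rewrite mulrC coefMXn /= subn2.
have : (E' (0, 1%R) * E' (0, 1%R))%g = E' (square K t' *: 'X^(c.-1), 0).
  by rewrite Ec'.2 /pmul /twist !(coef0, mulr0, mul0r, add0r, mulr1).
have -> : E' (square K t' *: 'X^(c.-1), 0) = square K t' *: E' ('X^(c.-1), 0).
  by rewrite -linearZ; congr (E' (_, _)); rewrite /= scaler0.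
rewrite vE Em powc -linearZ => /eqP; rewrite -subr_eq0 -raddfB => /eqP /ker[/= l _].
have := l c.-1 ltac:(lia); rewrite coefB coefD /twist /= Qlow; last by lia.
rewrite mulr0 mul0r add0r !coefZ coefXn eqxx !mulr1.
have [q ->] := (lowP _ _).1 Qlow.
have -> : 'X * ('X^(c - 2) * q) * ('X^(c - 2) * q)
    = (q * q) * 'X^(1 + (c - 2) + (c - 2)) by rewrite !exprD expr1; ring.
rewrite coefMXn; have -> : (c.-1 < 1 + (c - 2) + (c - 2))%N by lia.
by rewrite add0r expr2 mulrA => /eqP; rewrite subr_eq0 => /eqP.
Qed.

(** The kinds that are needed for class c. In the classes 1 and 2 only the algebra on
    the infinite path is ever compared with others by a presentation. For odd c the
    kind [SqM] is isomorphic to [SqP], by a to - a, and is left out. *)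
Definition admissible (c : nat) (t : kind) : bool :=
  if t == Main then (0 < c)%N else (2 < c)%N && ((t != SqM) || ~~ odd c).

Lemma admissible_gt1 c t : admissible c t -> (1 < c)%N || (t == Main) && (0 < c)%N.
Proof. by rewrite /admissible; case: eqP => // _; case: c => [|[|c]]. Qed.

Lemma square_eq0 t : (square K t == 0) = (t \in [:: Main; Nc0]).
Proof. by case: t; rewrite /= ?eqxx ?oppr_eq0 ?oner_eq0. Qed.

(** For classes above 2, commutativity and [pres_square], used in both directions,
    separate all kinds except [SqP] and [SqM]. For these two, c is even and
    y^2 = - x^c makes -1 a square. *)
Lemma pres_inj c d t t' (B : assocAlgType K) : admissible c t -> admissible d t' ->
  pres c t B -> pres d t' B -> c = d /\ canon t = canon t'.
Proof.
move=> a a' p p'.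
have cd : c = d by apply: has_class_uniq (pres_class _ p) (pres_class _ p');
  apply: admissible_gt1.
split=> //; move: a' p'; rewrite -{d}cd => a' p'.
have [c2|c2] := leqP c 2.
  by move: a a'; rewrite /admissible; do 2![case: eqP => [->|_]] => //; lia.
have C : (t \in [:: Nc0; Nc1]) = (t' \in [:: Nc0; Nc1]).
  apply: negb_inj; apply/idP/idP.
    by move/(pres_comm (ltnW c2) p)/(pres_comm (ltnW c2) p').
  by move/(pres_comm (ltnW c2) p')/(pres_comm (ltnW c2) p).
have [x [y [x0 e]]] := pres_square c2 p p'.
have [x' [y' [x'0 e']]] := pres_square c2 p' p.
have S : (t \in [:: Main; Nc0]) = (t' \in [:: Main; Nc0]).
  rewrite -!square_eq0; apply/eqP/eqP => z; apply/eqP; [move: e | move: e'];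
  by rewrite z mul0r => /esym/eqP;
    rewrite mulf_eq0 expf_eq0 ?(negPf x0) ?(negPf x'0) andbF orbF.
have sq (g h z w : K) : z != 0 -> ~~ odd c -> g * w ^+ 2 = h * z ^+ c ->
    g * h = -1 -> g ^+ 2 = 1 -> exists i : K, i ^+ 2 = -1.
  move=> z0 ev gh ghN gg; exists (w / z ^+ c./2).
  have zc : z ^+ c./2 ^+ 2 = z ^+ c by rewrite -exprM muln2 -[in RHS](odd_double_half
    c) (negPf ev).
  have -> : (w / z ^+ c./2) ^+ 2 = g ^+ 2 * w ^+ 2 / z ^+ c by rewrite gg mul1r
    expr_div_n zc.
  by rewrite expr2 -(mulrA g) gh mulrA ghN mulN1r mulNr mulfV // expf_neq0.
move: C S a a' e e'; rewrite /canon.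
case: t {p} => //; case: t' {p'} => //= _ _;
  rewrite /admissible /= ?andbF ?andbT => a a' e e'.
- have [//|[]] := asboolP; case/andP: a' => _ a'.
  apply: (sq _ _ _ _ x0 a' e); rewrite ?mul1r ?expr1n //.
- have [//|[]] := asboolP; case/andP: a => _ a.
  by apply: (sq _ _ _ _ x'0 a e'); rewrite ?mul1r ?expr1n.
Qed.

End Invariants.
(** * Contracted semigroup algebras *)

Section Contracted.
Variables (K : fieldType) (S : finSemigroup0).
Local Notation A := (contracted K S).

Definition of_sg (s : S) : A := qpi (zero_ideal K S) (sg_basis K s).

Definition comb (f : {ffun S -> K^o}) : A := \sum_s (f s : K) *: of_sg s.

(** Elements of the semigroup algebra are families of coordinates, so the projection
    is a linear combination of the classes of the semigroup elements. *)
Lemma qpi_comb (f : sg_alg K S) : qpi (zero_ideal K S) f = comb f.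
Proof.
have {1}-> : f = \sum_s (f s : K) *: sg_basis K s.
  apply/ffunP=> t; rewrite sum_ffunE (bigD1 t) //= big1 => [|s st].
    by rewrite !ffunE eqxx addr0; apply: esym; apply: mulr1.
  by rewrite !ffunE eq_sym (negPf st); apply: mulr0.
by rewrite raddf_sum; apply: eq_bigr => s _; apply: qpiZ.
Qed.

Fact comb_is_linear : linear comb.
Proof. by move=> a f g; rewrite -!qpi_comb linearP. Qed.

HB.instance Definition _ :=
  GRing.isLinear.Build K {ffun S -> K^o} A *:%R comb comb_is_linear.

Lemma comb_surj (x : A) : exists f, x = comb f.
Proof. by have [f ->] := qpi_surj x; exists f; apply: qpi_comb. Qed.

Lemma comb_eq0 f : comb f = 0 <-> forall s, s != szero -> f s = 0.
Proof.
rewrite -qpi_comb qpi_eq0; split.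
  move=> /asboolP[a ->] s s0; rewrite !ffunE (negPf s0); exact: mulr0.
move=> f0; apply/asboolP; exists (f szero); apply/ffunP=> s; rewrite !ffunE.
have [->|/f0 ->] := eqVneq s szero; apply: esym; first exact: mulr1.
exact: mulr0.
Qed.

(** The contracted algebra is thus covered by the space of families, with the
    multiplication of the semigroup algebra. *)
Lemma comb_mul f g : (comb f * comb g)%g = comb (sga_mul f g).
Proof. by rewrite -!qpi_comb -qpiM. Qed.

Lemma of_sg_eq0 s : of_sg s = 0 <-> s = szero.
Proof.
rewrite /of_sg qpi_comb comb_eq0; split=> [h|-> t t0]; last by rewrite ffunE (negPf t0).
apply/eqP; apply: contraT => /h /eqP.
by rewrite ffunE eqxx oner_eq0.
Qed.

Lemma of_sgM s t : of_sg (s * t)%g = (of_sg s * of_sg t)%g.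
Proof.
rewrite /of_sg -qpiM; congr qpi; apply/ffunP=> u; rewrite [RHS]ffunE.
rewrite (bigID (pred1 (s, t))) /= [X in _ = _ + X]big1 => [|[x y]]; last first.
  rewrite xpair_eqE !ffunE /= => /andP[_]; rewrite negb_and.
  by case/orP=> /negPf ->; rewrite ?mul0r ?mulr0.
rewrite addr0 ffunE; have [->|ne] := eqVneq.
  rewrite (big_pred1 (s, t)) => [|[x y] /=]; first by rewrite !ffunE !eqxx mulr1.
  by apply: andb_idl; rewrite xpair_eqE => /andP[/eqP -> /eqP ->].
rewrite big1 // => -[x y] /=; rewrite xpair_eqE => /andP[h /andP[/eqP xs /eqP yt]].
by rewrite xs yt eq_sym (negPf ne) in h.
Qed.

Lemma comb_indep (I : finType) (e : I -> S) (f : I -> K) :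
  injective e -> (forall i, e i != szero) ->
  \sum_i f i *: of_sg (e i) = 0 -> forall i, f i = 0.
Proof.
move=> e_inj e0 sum0 i.
pose g : {ffun S -> K^o} := [ffun s => \sum_(j | e j == s) f j].
have gE j : g (e j) = f j.
  by rewrite ffunE (big_pred1 j) // => k; rewrite (inj_eq e_inj).
rewrite -gE; apply: (comb_eq0 g).1 (e0 i).
rewrite -[RHS]sum0 /comb.
transitivity (\sum_s \sum_(j | e j == s) f j *: of_sg s).
  by apply: eq_bigr => s _; rewrite ffunE scaler_suml.
rewrite (exchange_big_dep predT) //=; apply: eq_bigr => j _.
by rewrite (big_pred1 (e j)) // => s; rewrite eq_sym.
Qed.

Lemma lprod_of_sg s t : of_sg (lprod s t) = lprod (of_sg s) (map of_sg t).
Proof. exact/lprod_morph/of_sgM. Qed.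

(** Membership in a power of the algebra is visible on the coordinates, because
    products expand into products of semigroup elements. *)
Definition supported (m : nat) (x : A) : Prop :=
  exists2 f, x = comb f &
    forall s, f s != 0 -> exists y t, size t = m /\ s = lprod y t.

Lemma lprod_supported x t : supported (size t) (lprod x t).
Proof.
elim/last_ind: t => [|t y [f fE fs]].
  by have [f ->] := comb_surj x; exists f => // s _; exists s, [::].
have [g ->] := comb_surj y; rewrite lprod_rcons fE comb_mul.
exists (sga_mul f g) => // u; rewrite ffunE.
case: (pickP (fun p : S * S => ((p.1 * p.2)%g == u) && (f p.1 != 0))).
  move=> [s v] /= /andP[/eqP <- /fs[z [w [wt ->]]]] _.
  by exists z, (rcons w v); rewrite !size_rcons wt lprod_rcons.
move=> no; rewrite big1 ?eqxx // => p pu; have := no p.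
by rewrite pu /= => /negbFE/eqP ->; rewrite mul0r.
Qed.

Lemma power_supported m x : x \in power_ideal A m -> supported m.-1 x.
Proof.
move/asboolP=> [s [sP ->]]; elim: s sP => [|q s IH] sP.
  by exists 0; rewrite ?big_nil ?raddf0 // => s; rewrite ffunE eqxx.
have [|f fE fs] := IH; first by move=> r rs; apply: sP; rewrite inE rs orbT.
rewrite big_cons fE.
have [|y [t [tm ->]]] := sP q; first by rewrite inE eqxx.
have [g -> gs] := lprod_supported y t.
exists (q.1 *: g + f); first by rewrite linearP.
move=> u; rewrite !ffunE; have [f0|/fs //] := eqVneq (f u) 0.
rewrite f0 addr0 => h; rewrite -tm; apply: gs; apply: contraNneq h => ->.
by rewrite scaler0.
Qed.

(** Semigroup and contracted algebra have the same class: the semigroup minus its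
    zero is a basis, and products of algebra elements expand into products of basis
    elements. *)
Lemma vanishing_contracted d : vanishing (0 : A) d <-> vanishing (szero : S) d.
Proof.
split=> [v s t td|v x t td].
  by apply/of_sg_eq0; rewrite lprod_of_sg v ?size_map.
have [f -> fs] := lprod_supported x t; apply/comb_eq0 => s.
by apply: contraNeq => /fs[y [w [wd ->]]]; rewrite v // wd.
Qed.

Lemma class_contracted d : has_class (0 : A) d <-> has_class (szero : S) d.
Proof.
by split=> -[v m]; split=> [|e ve]; try (apply/vanishing_contracted => //);
  apply: m; apply/vanishing_contracted.
Qed.

End Contracted.

Lemma sg_iso_zero (S T : finSemigroup0) (f : S -> T) : bijective f ->
  {morph f : x y / (x * y)%g} -> f szero = szero.
Proof.
move=> [g fK gK] fM.
by rewrite -[szero in LHS](mul0s (g szero)) fM gK muls0.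
Qed.

Lemma contracted_iso (K : fieldType) (S T : finSemigroup0) :
  sg_iso S T -> alg_iso (contracted K S) (contracted K T).
Proof.
move=> [g gb gM]; have [h gK hK] := gb.
pose r (f : {ffun S -> K^o}) : {ffun T -> K^o} := [ffun t => f (h t)].
have r_lin : linear r by move=> a f f'; apply/ffunP=> t; rewrite !ffunE.
pose R : {linear {ffun S -> K^o} -> {ffun T -> K^o}} :=
  HB.pack r (GRing.isLinear.Build K _ _ *:%R r r_lin).
pose E : {linear {ffun S -> K^o} -> contracted K S} := @comb K S.
pose E' : {linear {ffun S -> K^o} -> contracted K T} := @comb K T \o R.
have g0 := sg_iso_zero gb gM.
apply: (@alg_iso_of_covers _ _ (@sga_mul K S) _ _ E E').
- exact: comb_surj.
- move=> y; have [f ->] := comb_surj y; exists [ffun s => f (g s)].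
  by congr comb; apply/ffunP=> t; rewrite !ffunE hK.
- move=> f; rewrite /E /E' /R /= !comb_eq0; split=> z s s0.
    rewrite ffunE z //; apply: contraNneq s0 => e.
    by rewrite -(hK s) e g0.
  have := z (g s); rewrite ffunE gK; apply; apply: contraNneq s0 => e.
  by rewrite -(gK s) e -g0 gK.
- exact: comb_mul.
- move=> f f'; rewrite /E' /R /= comb_mul; congr comb; apply/ffunP=> t.
  rewrite !ffunE (reindex (fun p : S * S => (g p.1, g p.2))) /=; last first.
    by exists (fun p => (h p.1, h p.2)) => -[x y] _; rewrite /= ?gK ?hK.
  apply: eq_big => [[x y]|[x y] _] /=; last by rewrite !ffunE !gK.
  by rewrite -gM (can2_eq gK hK).
Qed.

Lemma sg_iso_refl (S : finSemigroup0) : sg_iso S S.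
Proof. by exists idfun => //; exists idfun. Qed.

Lemma sg_iso_sym (S T : finSemigroup0) : sg_iso S T -> sg_iso T S.
Proof.
case=> f [g fK gK] fM; exists g; first by exists f.
by move=> x y; apply: (can_inj fK); rewrite fM !gK.
Qed.

Lemma sg_iso_trans (S T U : finSemigroup0) :
  sg_iso S T -> sg_iso T U -> sg_iso S U.
Proof.
case=> f fb fM [g gb gM]; exists (g \o f); first exact: bij_comp.
by move=> x y; rewrite /= fM gM.
Qed.

Lemma sg_isotype_eq (S T : finSemigroup0) :
  sg_isotype S = sg_isotype T <-> sg_iso S T.
Proof.
split=> [e|ST].
  by have : sg_isotype S T by rewrite e; apply: sg_iso_refl.
apply/funext=> U; apply/propext; split; last exact: sg_iso_trans.
exact/sg_iso_trans/sg_iso_sym.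
Qed.
(** * Model semigroups *)

(** The triple (p, q, k) encodes ab = a^(p+1), ba = a^(q+1) and b^2 = a^k, where
    a^(c+1) is the zero. The conditions are those imposed by associativity. *)
Definition valid (c : nat) (x : nat * nat * nat) : bool :=
  let: (p, q, k) := x in
  [&& 1 < c, 0 < p <= c, 0 < q <= c, 1 < k <= c.+1 &
      (p == q) && (if p.*2 < c then k == p.*2 else c <= k)
      || [&& minn p q == c.-1, maxn p q == c & c <= k]]%N.

(** The index 0 stands for b, and an index e > 0 for a^e, with the zero at c + 1. *)
Definition mul_expo (c : nat) (x : nat * nat * nat) (e f : nat) : nat :=
  let: (p, q, k) := x in
  if e == 0 then (if f == 0 then k else minn (q + f) c.+1)
  else if f == 0 then minn (e + p) c.+1 else minn (e + f) c.+1.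

Lemma mul_expo_le c x e f : valid c x -> (mul_expo c x e f <= c.+1)%N.
Proof.
case: x => -[p q] k /= /and5P[_ _ _ /andP[_ kc] _].
by do ?case: ifP => _; rewrite ?geq_minr.
Qed.

Lemma mul_expoA c x e f g : valid c x -> (e <= c.+1)%N -> (f <= c.+1)%N ->
  (g <= c.+1)%N ->
  mul_expo c x e (mul_expo c x f g) = mul_expo c x (mul_expo c x e f) g.
Proof.
case: x => -[p q] k vx ec fc gc.
have {vx} : [/\ 1 < c, 0 < p <= c, 0 < q <= c, 1 < k <= c.+1 &
      [\/ p = q /\ k = p.*2, [/\ p = q, c <= p.*2 & c <= k],
          [/\ p.+1 = c, q = c & c <= k] | [/\ q.+1 = c, p = c & c <= k]]]%N.
  case/and5P: vx => c1 pc qc kc h; split=> //; case/orP: h.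
    case/andP=> /eqP pq; case: ifP => [_ /eqP|/negbT]; first by constructor 1.
    by rewrite -leqNgt; constructor 2.
  by move=> /and3P[/eqP h1 /eqP h2 ck]; have [pq|pq] := leqP p q;
    [constructor 3 | constructor 4]; split => //; lia.
move=> [c1 pc qc kc h].
case: e ec => [|e] ec; case: f fc => [|f] fc; case: g gc => [|g] gc;
  rewrite /mul_expo /=;
  repeat (case: ifP => ?); case: h => [[h1 h2]|[h1 h2 h3]|[h1 h2 h3]|[h1 h2 h3]]; lia.
Qed.

Record model_param (c : nat) := ModelParam { param : nat * nat * nat;
  _ : valid c param }.

Definition model (c : nat) (v : model_param c) : Type := 'I_c.+2.

Section Model.
Variables (c : nat) (v : model_param c).
Local Notation M := (model v).

Lemma paramP : valid c (param v). Proof. by case: v. Qed.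

HB.instance Definition _ := Finite.on M.

Definition gen (e : nat) : M := (inord e : 'I_c.+2).
Definition expo (x : M) : nat := (x : 'I_c.+2).

Lemma expo_le x : (expo x <= c.+1)%N. Proof. by rewrite -ltnS; apply: ltn_ord. Qed.
Lemma expoK : cancel expo gen. Proof. exact: inord_val. Qed.
Lemma genK e : (e <= c.+1)%N -> expo (gen e) = e. Proof. exact: inordK. Qed.

Lemma gen_inj e f : (e <= c.+1)%N -> (f <= c.+1)%N -> gen e = gen f -> e = f.
Proof. by move=> ec fc ef; rewrite -(genK ec) ef genK. Qed.

Definition model_mul (x y : M) : M := gen (mul_expo c (param v) (expo x) (expo y)).

Fact model_mulA : associative model_mul.
Proof.
move=> x y z; rewrite /model_mul !genK ?mul_expo_le ?paramP //.
by rewrite mul_expoA ?expo_le ?paramP.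
Qed.

HB.instance Definition _ := isSemigroup.Build M model_mulA.

Lemma genM e f : (e <= c.+1)%N -> (f <= c.+1)%N ->
  (gen e * gen f)%g = gen (mul_expo c (param v) e f).
Proof. by move=> ec fc; rewrite -{2}(genK ec) -{2}(genK fc). Qed.

Fact model_mul0 : left_zero (gen c.+1) (@monoid.mul M).
Proof.
move=> x; rewrite -[x]expoK genM ?expo_le //; congr gen.
by case: (param v) => -[p q] k /=; case: ifP => _; lia.
Qed.

Fact model_mul0r : right_zero (gen c.+1) (@monoid.mul M).
Proof.
move=> x; rewrite -[x]expoK genM ?expo_le //; congr gen.
by case: (param v) => -[p q] k /=; case: ifP => _; lia.
Qed.

HB.instance Definition _ := Semigroup_hasZero.Build M model_mul0 model_mul0r.

Lemma gen_eq0 e : (e <= c.+1)%N -> (gen e == szero) = (e == c.+1).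
Proof.
move=> ec; apply/eqP/eqP => [/gen_inj|->] //; exact.
Qed.

Lemma model_card : #|[set x : M | x != szero]| = c.+1.
Proof.
have -> : [set x : M | x != szero] = [set~ szero] by apply/setP=> x; rewrite !inE.
by rewrite cardsC1 -[RHS]/(c.+2.-1) -(card_ord c.+2).
Qed.

End Model.
(** * Presentations of the contracted algebras of the models *)

Section PresOfGenerators.
Variables (K : fieldType) (B : assocAlgType K) (a b : B) (c : nat) (t : kind).
Local Notation F := ({poly K} * K^o)%type.

Local Notation apow := (spow a).

Hypothesis c0 : (0 < c)%N.
Hypothesis ac : apow c = 0.
Hypothesis ab : (a * b)%g = noncomm K t *: apow c.-1.
Hypothesis ba : (b * a)%g = 0.
Hypothesis bb : (b * b)%g = square K t *: apow c.-1.
Hypothesis span : forall x, exists (f : 'I_c -> K) (d : K),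
  x = \sum_i f i *: apow i + d *: b.
Hypothesis indep : forall (f : 'I_c -> K) (d : K),
  \sum_i f i *: apow i + d *: b = 0 -> d = 0 /\ forall i, f i = 0.

Let ev (p : {poly K}) : B := \sum_(i < c) p`_i *: apow i.

Let ev_lin : linear ev.
Proof.
move=> x p q; rewrite /ev scaler_sumr -big_split; apply: eq_bigr => i _.
by rewrite coefD coefZ scalerDl scalerA.
Qed.

Let evB p q : ev (p - q) = ev p - ev q.
Proof. by rewrite addrC -scaleN1r ev_lin scaleN1r addrC. Qed.

Let evXM p : ev ('X * p) = (a * ev p)%g.
Proof.
rewrite /ev; case: (c) ac c0 => // c' ac' _.
rewrite big_ord_recl coefXM scale0r add0r big_ord_recr /= amulDr amulZr.
rewrite [X in _ + _ *: X]ac' scaler0 addr0 amul_sumr.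
by apply: eq_bigr => i _; rewrite coefXM /= amulZr.
Qed.

Let evX n : (n < c)%N -> ev 'X^n = apow n.
Proof.
move=> nc; rewrite /ev (bigD1 (Ordinal nc)) //= coefXn eqxx scale1r big1 ?addr0 //.
move=> i; rewrite -val_eqE /= => h; rewrite coefXn (negPf h) scale0r //.
Qed.

Let ev0 : ev 0 = 0.
Proof. by rewrite -[0](subrr 0) evB subrr. Qed.

Let evD p q : ev (p + q) = ev p + ev q.
Proof. by rewrite -[p]scale1r ev_lin !scale1r. Qed.

Let evZ x p : ev (x *: p) = x *: ev p.
Proof. by rewrite -[x *: p]addr0 ev_lin ev0 addr0. Qed.

Let evM p q : (ev p * ev q)%g = ev ('X * p * q)%R.
Proof.
elim/poly_ind: p => [|p x IH].
  by rewrite mulr0 mul0r ev0 amul0l.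
rewrite [p * 'X]mulrC mulrDr mulrDl !evD evXM amulDl -mulgA IH -evXM.
congr (ev _ + _); first by ring.
have -> : ev x%:P = x *: a.
  by rewrite -[x%:P]mulr1 mul_polyC evZ -[1]/('X^0) evX.
rewrite amulZl -evXM -evZ; congr ev.
by rewrite -mul_polyC; ring.
Qed.

Let apow_b n : (0 < n)%N -> (apow n * b)%g = 0.
Proof.
case: n => // n _; elim: n => [|n IH].
  by rewrite /= -mulgA ab amulZr -[(a * _)%g]/(apow c.-1.+1) (prednK c0) ac scaler0.
by rewrite [apow _]/= -mulgA IH amul0r.
Qed.

Let b_apow n : (b * apow n)%g = 0.
Proof. by case: n => [|n] //=; rewrite mulgA ba amul0l. Qed.

Let ev_b p : (ev p * b)%g = (noncomm K t * p`_0) *: apow c.-1.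
Proof.
rewrite /ev amul_suml (bigD1 (Ordinal c0)) //= big1 => [|i i0]; last first.
  by rewrite amulZl apow_b ?scaler0 // lt0n; move: i0; rewrite -val_eqE.
by rewrite addr0 amulZl ab scalerA mulrC.
Qed.

Let b_ev p : (b * ev p)%g = 0.
Proof.
by rewrite /ev amul_sumr big1 // => i _; rewrite amulZr b_apow scaler0.
Qed.

Let cov (u : F) : B := ev u.1 + (u.2 : K) *: b.

Let cov_lin : linear cov.
Proof.
move=> x u v; rewrite /cov /= ev_lin scalerDr scalerDl scalerA.
by rewrite -!addrA; congr (_ + _); rewrite addrCA.
Qed.

(** The relations give the multiplication of the elements P(a) a + d b, and the
    basis a, ..., a^c, b the kernel of the map that sends (P, d) to them. *)
Lemma pres_of_gens : pres c t B.
Proof.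
pose E : {linear F -> B} := HB.pack cov (GRing.isLinear.Build K F B *:%R cov cov_lin).
exists E; first split=> [x|u v].
- have [f [d ->]] := span x.
  exists (\sum_i f i *: 'X^i, d); rewrite /E /= /cov /=; congr (_ + _).
  rewrite (big_morph ev evD ev0); apply: eq_bigr => i _.
  by rewrite evZ evX.
- rewrite /E /= /cov /= scale0r addr0 amulDl !amulDr evM evD evZ evX ?ltn_predL //.
  rewrite -!addrA; congr (_ + _).
  rewrite !amulZr !amulZl ev_b b_ev bb !scaler0 add0r !scalerA -scalerDl.
  congr (_ *: _); rewrite /twist; ring.
- move=> u; rewrite /E /= /cov; split.
    move=> /indep [d0 z]; split=> // i ic.
    exact: (z (Ordinal ic)).
  move=> [z ->]; rewrite scale0r addr0 /ev big1 // => i _.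
  by rewrite z ?scale0r.
Qed.
End PresOfGenerators.

Section ModelPres.
Variables (K : fieldType) (c : nat) (v : model_param c).
Local Notation A := (contracted K (model v)).

(** For p = q the substitution b - a^p kills ab and ba, and turns b^2 into
    a^k - a^(2p), where powers beyond the c-th vanish. For p <> q the products ab
    and ba cannot both be removed. *)
Definition kind_of (c : nat) (x : nat * nat * nat) : kind :=
  let: (p, q, k) := x in
  if p == q then
    if k == minn p.*2 c.+1 then Main else if k == c then SqP else SqM
  else if k == c then Nc1 else Nc0.

Let z e : A := of_sg K (gen v e).

Let zM e f : (e <= c.+1)%N -> (f <= c.+1)%N ->
  (z e * z f)%g = z (mul_expo c (param v) e f).
Proof. by move=> ec fc; rewrite /z -of_sgM genM. Qed.

Let z0 : z c.+1 = 0.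
Proof. exact/of_sg_eq0. Qed.

Let zpow i : (i <= c)%N -> spow (z 1) i = z i.+1.
Proof.
elim: i => //= i IH ic; rewrite IH 1?ltnW // zM ?ltnS ?(ltnW ic) //.
by rewrite /mul_expo; case: (param v) => -[p q] k /=; congr z; lia.
Qed.

Let z_sum m : (0 < m <= c)%N -> z m = \sum_(i < c) (i.+1 == m)%:R *: z i.+1.
Proof.
case: m => // m mc; rewrite (bigD1 (Ordinal mc)) //= eqxx scale1r big1 ?addr0 //.
by move=> i; rewrite eqSS -val_eqE /= => /negPf ->; rewrite scale0r.
Qed.

Let apow_sum (f : 'I_c -> K) :
  \sum_(i < c) f i *: spow (z 1) i = \sum_(i < c) f i *: z i.+1.
Proof. by apply: eq_bigr => i _; rewrite zpow // ltnW. Qed.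

Section Generator.
Variables (b : A) (r s : K) (m : nat).
Hypotheses (r0 : r != 0) (mc : (0 < m <= c)%N) (bE : b = r *: z 0 + s *: z m).

Let model_span x : exists (f : 'I_c -> K) (d : K),
  x = \sum_(i < c) f i *: spow (z 1) i + d *: b.
Proof.
have [f ->] := comb_surj x; pose d : K := r^-1 * f (gen v 0).
exists (fun i => f (gen v i.+1) - d * s * (i.+1 == m)%:R), d.
have dr : d * r = f (gen v 0) by rewrite /d mulrAC mulVf // mul1r.
rewrite apow_sum bE scalerDr !scalerA dr.
under eq_bigr do rewrite scalerBl -scalerA.
rewrite sumrB -scaler_sumr -(z_sum mc) addrACA addNr addr0 addrC.
transitivity (\sum_(i < c.+2) (f (gen v i) : K) *: z i).
  by apply: eq_bigr => i _; rewrite /z [gen v i]expoK.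
rewrite big_ord_recl big_ord_recr /= z0 scaler0 addr0 addrC.
by congr (_ + _); apply: eq_bigr.
Qed.

Let model_indep (f : 'I_c -> K) (d : K) :
  \sum_(i < c) f i *: spow (z 1) i + d *: b = 0 -> d = 0 /\ forall i, f i = 0.
Proof.
rewrite apow_sum bE scalerDr !scalerA (z_sum mc) scaler_sumr addrCA -big_split /=.
pose h (i : 'I_c.+1) : K :=
  if unlift ord0 i is Some j then f j + d * s * (j.+1 == m)%:R else d * r.
move=> e; have : \sum_(i < c.+1) h i *: z i = 0.
  rewrite big_ord_recl -[RHS]e; congr (_ + _); first by rewrite /h unlift_none.
  by apply: eq_bigr => i _; rewrite /h liftK scalerDl scalerA.
move/comb_indep => hz.
have {}hz i : h i = 0.
  apply: hz => [j k /gen_inj|j]; first by move=> jk; apply/val_inj/jk; rewrite ltnW.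
  by have jc := ltn_ord j; rewrite gen_eq0 ?ltn_eqF // ltnW.
have d0 : d = 0.
  have /eqP := hz ord0; rewrite /h unlift_none mulf_eq0 (negPf r0) orbF.
  by move/eqP.
split=> // i; have := hz (lift ord0 i).
by rewrite /h liftK d0 !mul0r addr0.
Qed.

(** Any element with a non-zero coefficient at b completes the powers of a to a
    basis. *)
Lemma pres_model_gens t : (0 < c)%N ->
  (z 1 * b)%g = noncomm K t *: z c -> (b * z 1)%g = 0 ->
  (b * b)%g = square K t *: z c -> pres c t A.
Proof.
move=> c0 ab ba bb; have cc : z c = spow (z 1) c.-1 by rewrite zpow ?prednK ?leq_pred.
by apply: (@pres_of_gens _ _ (z 1) b); rewrite -?cc ?zpow.
Qed.
End Generator.

(** For p = c - 1, q = c the generator b itself has ab = a^c and ba = 0; for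
    p = c, q = c - 1 the same holds for a^(c-1) - b, which makes the two
    anti-isomorphic semigroups have isomorphic algebras. *)
Lemma pres_model : (2 < c)%N || (kind_of c (param v) == Main) ->
  pres c (kind_of c (param v)) A.
Proof.
have z0' n : n = c.+1 -> z n = 0 by move=> ->.
have := paramP v; have := zM; case: (param v) => -[p q] k; rewrite /mul_expo => zM'.
move=> /and5P[c1 pc qc kc h].
have z10 : (z 1 * z 0)%g = z (minn (1 + p) c.+1) by rewrite zM'.
have z01 : (z 0 * z 1)%g = z (minn (q + 1) c.+1) by rewrite zM'.
have z00 : (z 0 * z 0)%g = z k by rewrite zM'.
have zn0 n : (0 < n <= c)%N -> (z n * z 0)%g = z (minn (n + p) c.+1).
  by case: n => // n nc; rewrite zM' // ltnW.
have z0n n : (0 < n <= c)%N -> (z 0 * z n)%g = z (minn (q + n) c.+1).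
  by case: n => // n nc; rewrite zM' // ltnW.
have znn n l : (0 < n <= c)%N -> (0 < l <= c)%N ->
  (z n * z l)%g = z (minn (n + l) c.+1).
  by case: n => // n; case: l => // l nc lc; rewrite zM' // ltnW.
have c1' : (0 < 1 <= c)%N by lia.
rewrite /kind_of; have [pq|pq] := eqVneq p q.
  move=> _; subst q; rewrite eqxx /= in h.
  have {}h : (k == p.*2) || (c <= p.*2)%N && (c <= k)%N.
    by move: h; case: ifP => [_|]; lia.
  apply: (@pres_model_gens (z 0 - z p) 1 (-1) p); rewrite ?oner_eq0 //; try lia.
  - by rewrite scale1r scaleN1r.
  - rewrite amulDr amulNr z10 znn // subrr.
    by do 2?[case: ifP => _]; rewrite /noncomm scale0r.
  - by rewrite amulDl -scaleN1r amulZl scaleN1r z01 znn // subrr.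
  rewrite amulDl !amulDr -scaleN1r !amulZl !amulZr !scaleN1r z00 zn0 // z0n // znn //.
  rewrite opprK addNr addr0; case: ifP => [/eqP ->|kp].
    by rewrite -addnn subrr scale0r.
  case: ifP => [/eqP kE|kE].
    by rewrite scale1r [z (minn _ _)]z0' ?subr0 ?kE //; lia.
  rewrite scaleN1r [z k]z0' ?sub0r; last by lia.
  by congr (- z _); lia.
case/orP=> [c2|/eqP]; last by case: ifP.
have ck : (c.+1 == c) = false by lia.
have {}h : [&& minn p q == c.-1, maxn p q == c & c <= k]%N.
  by move: h; rewrite (negPf pq).
(* Four cases: b^2 is the last power or zero, and (p, q) is (c-1, c) or (c, c-1). *)
have [k1|k1] : k = c \/ k = c.+1 by lia.
all: have {pq} [[pE qE]|[pE qE]] : (p = c.-1 /\ q = c) \/ (q = c.-1 /\ p = c) by lia.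
- apply: (@pres_model_gens (z 0) 1 0 c); rewrite ?oner_eq0 //; try lia.
  + by rewrite scale1r scale0r addr0.
  + by rewrite z10 k1 eqxx /noncomm scale1r; congr z; lia.
  + by rewrite z01 z0' //; lia.
  + by rewrite z00 k1 eqxx scale1r.
- apply: (@pres_model_gens (z c.-1 - z 0) (-1) 1 c.-1);
  rewrite ?oppr_eq0 ?oner_eq0 //; try lia.
  + by rewrite scale1r scaleN1r addrC.
  + rewrite amulDr amulNr z10 znn //; last by lia.
    rewrite k1 eqxx /noncomm scale1r [z (minn (1 + p) _)]z0' ?subr0; last by lia.
    by congr z; lia.
  + rewrite amulDl -scaleN1r amulZl scaleN1r z01 znn //; last by lia.
    by rewrite pE subrr.
  rewrite amulDl !amulDr -scaleN1r !amulZl !amulZr !scaleN1r z00 zn0 ?z0n ?znn //;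
    try lia.
  rewrite [z (minn (c.-1 + c.-1) _)]z0'; last by lia.
  rewrite [z (minn (c.-1 + p) _)]z0'; last by lia.
  rewrite [z (minn (q + c.-1) _)]z0'; last by lia.
  by rewrite !(oppr0, add0r) opprK k1 eqxx scale1r.
- apply: (@pres_model_gens (z 0) 1 0 c); rewrite ?oner_eq0 //; try lia.
  + by rewrite scale1r scale0r addr0.
  + by rewrite z10 k1 ck /noncomm scale1r; congr z; lia.
  + by rewrite z01 z0' //; lia.
  + by rewrite z00 k1 ck z0 scale0r.
- apply: (@pres_model_gens (z c.-1 - z 0) (-1) 1 c.-1);
  rewrite ?oppr_eq0 ?oner_eq0 //; try lia.
  + by rewrite scale1r scaleN1r addrC.
  + rewrite amulDr amulNr z10 znn //; last by lia.
    rewrite k1 ck /noncomm scale1r [z (minn (1 + p) _)]z0' ?subr0; last by lia.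
    by congr z; lia.
  + rewrite amulDl -scaleN1r amulZl scaleN1r z01 znn //; last by lia.
    by rewrite pE subrr.
  rewrite amulDl !amulDr -scaleN1r !amulZl !amulZr !scaleN1r z00 zn0 ?z0n ?znn //;
    try lia.
  rewrite [z (minn (c.-1 + c.-1) _)]z0'; last by lia.
  rewrite [z (minn (c.-1 + p) _)]z0'; last by lia.
  rewrite [z (minn (q + c.-1) _)]z0'; last by lia.
  by rewrite k1 ck z0 !oppr0 !addr0 scale0r.
Qed.
End ModelPres.
(** * Nilpotent semigroups of coclass one *)

Section Coclass1.
Variables (S : finSemigroup0) (c : nat).
Hypothesis cl : has_class (szero : S) c.
Hypothesis card_nz : #|[set x : S | x != szero]| = c.+1.

Definition long_product (n : nat) (x : S) : Prop :=
  exists y t, size t = n /\ x = lprod y t.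

Lemma long_product0 x : long_product 0 x. Proof. by exists x, [::]. Qed.

Lemma long_product_mull n x g : long_product n x -> long_product n.+1 (g * x)%g.
Proof.
by move=> [y [t [tn ->]]]; exists g, (y :: t); rewrite /= tn lprod_cons.
Qed.

Lemma long_product_mulr n x g : long_product n x -> long_product n.+1 (x * g)%g.
Proof.
by move=> [y [t [tn ->]]]; exists y, (rcons t g); rewrite size_rcons tn lprod_rcons.
Qed.

Lemma long_product_eq0 n x : (c <= n)%N -> long_product n x -> x = szero.
Proof.
by move=> cn [y [t [tn ->]]]; apply: (vanishing_leq (@mul0s S) cn cl.1).
Qed.

(** Otherwise x would be a product of arbitrarily many elements. *)
Lemma fixed_mull (x g : S) : x = (g * x)%g -> x = szero.
Proof.
move=> e; apply: (long_product_eq0 (leqnn c)).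
by elim: c => [|n IH]; [apply: long_product0 | rewrite e; apply: long_product_mull].
Qed.

Lemma fixed_mulr (x g : S) : x = (x * g)%g -> x = szero.
Proof.
move=> e; apply: (long_product_eq0 (leqnn c)).
by elim: c => [|n IH]; [apply: long_product0 | rewrite e; apply: long_product_mulr].
Qed.

Lemma class_gt0 : (0 < c)%N.
Proof.
case: posnP => // c0; suff : #|[set x : S | x != szero]| = 0%N by rewrite card_nz.
apply/eqP; rewrite cards_eq0; apply/eqP/setP=> x; rewrite !inE; apply/negbTE.
by rewrite negbK; apply/eqP/(long_product_eq0 _ (long_product0 x)); rewrite c0.
Qed.

Lemma longest_word : exists (x : S) s, size s = c.-1 /\ lprod x s != szero.
Proof.
apply: contrapT => no; suff /cl.2 : vanishing (szero : S) c.-1.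
  by rewrite leqNgt ltn_predL class_gt0.
move=> x s sc; apply/eqP; apply: contraT => ne; case: no.
by exists x, s.
Qed.

(** There are only c + 1 non-zero elements. *)
Lemma remaining (f : 'I_c -> S) : injective f -> (forall i, f i != szero) ->
  exists z, [/\ z != szero, forall i, z != f i &
    forall x, x != szero -> x = z \/ exists i, x = f i].
Proof.
move=> f_inj f0; pose N := [set x : S | x != szero]; pose D := [set f i | i : 'I_c].
have DN : D \subset N by apply/subsetP=> x /imsetP[i _ ->]; rewrite inE.
have cD : #|D| = c by rewrite card_imset // card_ord.
have /cards1P[z zE] : #|N :\: D| == 1%N.
  by rewrite cardsD (setIidPr DN) cD card_nz subSnn.
have := set11 z; rewrite -zE !inE => /andP[zD z0]; exists z; split=> //.
  by move=> i; apply: contraNneq zD => ->; apply: imset_f.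
move=> x x0; have [/imsetP[i _ ->]|xD] := boolP (x \in D); first by right; exists i.
by left; apply/eqP; rewrite -in_set1 -zE !inE xD.
Qed.

Section Monogenic.
Variable a : S.
Hypothesis c2 : (1 < c)%N.
Hypothesis ac : spow a c.-1 != szero.

Let spow0 n : (c <= n)%N -> spow a n = szero.
Proof.
move=> cn; apply: (long_product_eq0 cn); exists a, (nseq n a).
by rewrite size_nseq spow_lprod.
Qed.

Let spow_neq0 n : (n < c)%N -> spow a n != szero.
Proof.
move=> nc; apply: contraNneq ac => n0.
have [->|n1] := eqVneq c.-1 n; first by rewrite n0.
have -> : c.-1 = (n + (c.-1 - n).-1).+1 by lia.
by rewrite -spowD n0 mul0s.
Qed.

Let spow_eq i j : spow a i = spow a j -> i = j \/ (c <= i)%N /\ (c <= j)%N.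
Proof.
wlog ij : i j / (i < j)%N.
  have [ij|ij|->] := ltngtP i j; [exact | | by left].
  by move=> /(_ _ _ ij) h /esym/h[->|[]]; [left | right].
move=> e; right; suff ci : (c <= i)%N by split=> //; apply: leq_trans ci (ltnW ij).
rewrite leqNgt; apply/negP=> ic; have := ac.
suff -> : spow a c.-1 = szero by rewrite eqxx.
have [ci|ci] := eqVneq c.-1 i; first by rewrite ci e spow0 //; lia.
have -> : c.-1 = (i + (c.-1 - i).-1).+1 by lia.
by rewrite -spowD e spowD spow0 //; lia.
Qed.

(** The powers of a and one further element b exhaust the semigroup. The products ab
    and ba are neither a nor b by nilpotency, and b^2 = a would write a^c as a
    product of 2c factors. The remaining constraints on the exponents come from
    (ab)a = a(ba), (ab)b = a(bb) and b(ba) = (bb)a. *)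
Lemma iso_model : exists v : model_param c, sg_iso (model v) S.
Proof.
have [|i|b [b0 bi all]] := @remaining (fun i => spow a i).
- by move=> i j /spow_eq [/val_inj //|[]]; rewrite leqNgt ltn_ord.
- exact: spow_neq0.
have {}all x : x = b \/ exists2 i, (i <= c)%N & x = spow a i.
  have [->|/all[->|[i ->]]] := eqVneq x szero; [right|by left|right].
    by exists c; rewrite ?spow0.
  by exists (val i); [apply/ltnW/ltn_ord |].
have a0 : a <> szero by apply/eqP; apply: (spow_neq0 (n := 0)); apply: ltnW.
have [p [/andP[p0 pc] abE]] : exists p, (0 < p <= c)%N /\ (a * b)%g = spow a p.
  have [/esym/fixed_mull/eqP|[[|i] ic e]] := all (a * b)%g; first by rewrite (negPf b0).
    by move/esym/fixed_mulr: e.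
  by exists i.+1.
have [q [/andP[q0 qc] baE]] : exists q, (0 < q <= c)%N /\ (b * a)%g = spow a q.
  have [/esym/fixed_mulr/eqP|[[|i] ic e]] := all (b * a)%g; first by rewrite (negPf b0).
    by move/esym/fixed_mull: e.
  by exists i.+1.
have [k [/andP[k1 kc] bbE]] : exists k, (1 < k <= c.+1)%N /\ (b * b)%g = spow a k.-1.
  have [/esym/fixed_mulr/eqP|[[|i] ic e]] := all (b * b)%g; first by rewrite (negPf b0).
    (* If b^2 = a then a^(n+1) = b^(2n+2). *)
    have bs n : spow a n = spow b (n + n).+1.
      by elim: n => [|n IH]; rewrite ?addSn ?addnS //= IH -{1}[a]e /= -!mulgA.
    case/eqP: ac; rewrite bs; apply: (@long_product_eq0 (c.-1 + c.-1).+1); first by lia.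
    by exists b, (nseq (c.-1 + c.-1).+1 b); rewrite size_nseq spow_lprod.
  by exists i.+2.
have apb i : (spow a i * b)%g = spow a (i + p).
  by elim: i => //= i IH; rewrite -mulgA IH.
have bap i : (b * spow a i)%g = spow a (q + i).
  case: i => [|i]; first by rewrite addn0.
  by rewrite /= mulgA baE spowD addnS.
have e1 : p.+1 = q.+1 \/ (c <= p.+1)%N /\ (c <= q.+1)%N.
  apply: spow_eq; rewrite -[in LHS](addn0 p) -spowD /= -abE -mulgA baE.
  by [].
have e2 : p + p = k \/ (c <= p + p)%N /\ (c <= k)%N.
  apply: spow_eq; rewrite -apb -abE -mulgA bbE -[LHS]/(spow a k.-1.+1).
  by case: (k) k1.
have e3 : q + q = k \/ (c <= q + q)%N /\ (c <= k)%N.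
  apply: spow_eq; rewrite -bap -baE mulgA bbE -[a in LHS]/(spow a 0) spowD addn0.
  by case: (k) k1.
have vx : valid c (p, q, k).
  rewrite /= c2 p0 pc q0 qc k1 kc /=; have [pq|pq] /= := eqVneq p q; last by lia.
  by case: ifP => pc2; lia.
exists (ModelParam vx); set v := ModelParam vx.
pose phi (x : model v) : S := if expo x == 0 then b else spow a (expo x).-1.
have phiS n : (0 < n)%N -> phi (gen v (minn n c.+1)) = spow a n.-1.
  move=> n0; rewrite /phi genK ?geq_minr //.
  have -> : (minn n c.+1 == 0) = false by lia.
  by case: leqP => nc //=; rewrite !spow0 //; lia.
exists phi.
  apply: inj_card_bij => [x y|]; last first.
    have : #|S|.-1 = c.+1 by rewrite -(cardC1 (szero : S)) -card_nz cardsE.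
    by rewrite [X in (_ <= X)%N](card_ord c.+2); case: #|_| => //= n ->.
  move=> e; rewrite -(expoK x) -(expoK y); congr gen; move: e; rewrite /phi.
  have := expo_le x; have := expo_le y.
  have bs n : (n <= c)%N -> b != spow a n.
    rewrite leq_eqVlt => /predU1P[->|nc]; first by rewrite spow0.
    exact: (bi (Ordinal nc)).
  case: (expo x) => [|i]; case: (expo y) => [|j] //= jc ic.
  - by move/eqP; rewrite (negPf (bs j _)) // -ltnS.
  - by move/esym/eqP; rewrite (negPf (bs i _)) // -ltnS.
  by move=> /spow_eq; lia.
move=> x y; rewrite -[x]expoK -[y]expoK; have := expo_le x; have := expo_le y.
move: (expo x) (expo y) => i j jc ic; rewrite genM // {2 3}/phi !genK //.
rewrite /mul_expo /v /=; case: i ic => [|i] ic; case: j jc => [|j] jc /=.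
- by rewrite bbE -phiS ?(minn_idPl kc) // ltnW.
- by rewrite phiS ?bap ?addnS // ltn_addr.
- by rewrite phiS // apb addSn.
- by rewrite phiS // spowD addnS addSn.
Qed.

End Monogenic.

(** Take a non-zero product of c elements, with first factor x0, and the non-zero
    element z left over by its prefixes. A factor that is a product would make the
    word too long, so all letters are x0 or z, and two adjacent letters multiply to
    the second prefix or to z. If z is a product, it cannot be a letter, and the word
    is a power of x0. Otherwise any two adjacent letters have the same product. Since
    there are only two letters, rewriting with this equality exhibits a square aa
    with this value, and then the letters after aa can be replaced by a one by one. *)
Lemma cyclic_generator : (2 < c)%N -> exists a : S, spow a c.-1 != szero.
Proof.
move=> c2; have [x0 [s [sc ne]]] := longest_word.
(* C l g r is the product of the word l g r, for a marked letter g. *)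
pose C l g r : S := lprod (foldr (@monoid.mul S) g l) r.
have deepC n l g r : long_product n g -> long_product (n + size l + size r) (C l g r).
  move=> dg; have : long_product (n + size l) (foldr (@monoid.mul S) g l).
    by elim: l => [|x l IH] /=; rewrite ?addn0 // addnS; apply: long_product_mull.
  rewrite /C; elim/last_ind: r => [|r x IH]; first by rewrite addn0.
  by move/IH=> h; rewrite lprod_rcons size_rcons addnS; apply: long_product_mulr.
have notdeep n l g r : C l g r != szero -> (c <= n + size l + size r)%N ->
  ~ long_product n g.
  by move=> Cn cn /(deepC _ l _ r)/(long_product_eq0 cn)/eqP; rewrite (negPf Cn).
have C_neq0 l g r : C l g r != szero -> g != szero.
  apply: contraNneq => ->; rewrite /C; elim: l => [|x l IH] /=.
    by elim: r => //= x r IH; rewrite /lprod /= mul0s.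
  suff -> : foldr (@monoid.mul S) szero l = szero by rewrite muls0;
    elim: r {IH} => //= y r IH; rewrite /lprod /= mul0s.
  by elim: l {IH} => //= y l ->; rewrite muls0.
pose y (i : 'I_c) := lprod x0 (take i s).
have ydeep (i : 'I_c) : long_product i (y i).
  by exists x0, (take i s); rewrite size_takel // sc; have := ltn_ord i; lia.
have ydrop i : lprod (y i) (drop i s) = lprod x0 s by rewrite -lprod_cat cat_take_drop.
have y_inj : injective y.
  move=> i j; wlog ij : i j / (i < j)%N.
    have [ij|ij|/val_inj //] := ltngtP i j; first exact.
    by move=> h /esym /h ->.
  move=> e; case/eqP: ne; rewrite -(ydrop i) e.
  apply: (@long_product_eq0 (j + size (drop i s))); first by rewrite size_drop sc;
    have := ltn_ord j; lia.
  have := deepC j [::] (y j) (drop i s) (ydeep j); by rewrite addn0.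
have y0 i : y i != szero.
  by have := ne; rewrite -(ydrop i); apply: (@C_neq0 [::]).
have [z [_ _ all]] := remaining y_inj y0.
have letter l g r : (size l + size r = c.-1)%N -> C l g r != szero -> g = x0 \/ g = z.
  move=> lr Cn; have [->|[i gi]] := all g (C_neq0 _ _ _ Cn); first by right.
  have [i0|i0] := posnP i; first by left; rewrite gi /y i0 take0.
  by case: (notdeep i l g r Cn); [lia | rewrite gi; apply: ydeep].
have x0deep : ~ long_product 1 x0 by apply: (@notdeep _ [::] _ s); rewrite ?sc //=; lia.
have CE x l g r : C (x :: l) g r = lprod x (l ++ g :: r).
  elim: l x => // u l IH x.
  by rewrite -[RHS]/(lprod (x * u)%g (l ++ g :: r)) -IH /C /= mulgA.
case: (pselect (long_product 1 z)) => [dz|ndz].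
  exists x0; rewrite spow_lprod; suff <- : s = nseq c.-1 x0 by [].
  rewrite -sc; apply/all_pred1P/allP=> g gs; apply/eqP.
  case/splitPr: gs (sc) ne => l r; rewrite size_cat /= => lr; rewrite -CE => Cn.
  have [||//|gz] := letter (x0 :: l) g r; [by move=> /=; lia | exact: Cn |].
  by case: (@notdeep 1 (x0 :: l) g r Cn); rewrite ?gz //=; lia.
have {all} prefix v : v != szero ->
  v = z \/ exists2 i, (i < c)%N & v = lprod x0 (take i s).
  by case/all=> [|[i ->]]; [left | right; exists i => //; apply: ltn_ord].
case: s sc ne prefix {y ydeep ydrop y_inj y0} => [|g1 s] sc ne prefix.
  by move: sc => /=; lia.
have pairE l g h r : (size l + size r = c.-2)%N -> C l (g * h)%g r != szero ->
    (g * h)%g = (x0 * g1)%g.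
  move=> lr Cn; have d1 : long_product 1 (g * h)%g by
    apply/long_product_mull/long_product0.
  have [gz|[[|[|i]] ic gi]] := prefix _ (C_neq0 _ _ _ Cn); first by rewrite gz in d1.
  - by rewrite gi in d1.
  - by rewrite gi /= take0.
  case: (notdeep i.+2 l (g * h)%g r Cn); first by lia.
  rewrite gi; exists x0, (take i.+2 (g1 :: s)).
  by rewrite size_takel // sc; lia.
have [a aa] : exists a, (a * a)%g = (x0 * g1)%g.
  have [||g1E|g1E] := letter [:: x0] g1 s; rewrite ?CE //.
  - by exists x0; rewrite g1E.
  case: s sc ne prefix pairE => [|g2 s] sc ne prefix pairE; first by move: sc => /=;
    lia.
  have [||g2E|g2E] := letter [:: x0; g1] g2 s; rewrite ?CE //.
  - exists x0.
    have e : (g1 * g2)%g = (x0 * g1)%g.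
      apply: (pairE [:: x0] _ _ s); first by move: sc => /=; lia.
      by have := ne; rewrite /C /lprod /= mulgA.
    apply: (pairE [::] _ _ (g1 :: s)); first by move: sc => /=; lia.
    by have := ne; rewrite /C /lprod /= -!mulgA e -g2E !mulgA.
  exists z; rewrite -{1}g1E -g2E.
  apply: (pairE [:: x0] _ _ s); first by move: sc => /=; lia.
  by have := ne; rewrite /C /lprod /= mulgA.
exists a.
suff step t m : (0 < m)%N -> (m + size t = c.-1)%N -> lprod (spow a m) t != szero ->
    spow a c.-1 != szero.
  by apply: (step s 1); rewrite //= aa.
elim: t m => [|h t IH] m m0 mt hn; first by rewrite -mt addn0.
apply: (IH m.+1) => //; first by rewrite -mt addSnnS.
have pE n : (spow a n * h)%g = foldr (@monoid.mul S) (a * h)%g (nseq n a).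
  by elim: n => //= n <-; rewrite mulgA.
move: hn; rewrite lprod_cons -lprod_mull pE => hn.
suff ah : (a * h)%g = (a * a)%g.
  by move: hn; rewrite ah; congr (lprod _ _ != _); elim: (m) => //= n ->.
rewrite aa; apply: (pairE (nseq m a) _ _ t) => //.
by rewrite size_nseq; move: mt => /=; lia.
Qed.

End Coclass1.
(** * Isomorphisms between models *)

Section ModelElements.
Variables (c : nat) (v : model_param c).

Lemma gen_prod x y : (1 < expo (x * y : model v)%g)%N.
Proof.
rewrite genK; last exact/mul_expo_le/paramP.
have := paramP v; case: (param v) => -[p q] k /and5P[c1 pc qc kc _]; rewrite /mul_expo.
by case: ifP => x0; case: ifP => y0; lia.
Qed.

Lemma genS e : (0 < e <= c)%N -> gen v e.+1 = (gen v 1 * gen v e)%g.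
Proof.
move=> ec; rewrite genM //; last by lia.
by case: (param v) => -[p q] k; congr gen; rewrite /mul_expo /=; case: ifP => e0; lia.
Qed.

End ModelElements.

(** The elements a and b are the only ones that are not products, so an isomorphism
    fixes or exchanges them. If it fixes them the exponents can be read off. If it
    exchanges them then b^c is not zero, which forces all four products of a and b
    to be equal. The hypothesis on k is automatic for c > 2. *)
Lemma model_inj c (v v' : model_param c) :
  (let: (p, q, k) := param v' in k = 2%N -> p = 1%N /\ q = 1%N) ->
  sg_iso (model v) (model v') -> param v = param v'.
Proof.
move=> good [f fb fM]; have f0 := sg_iso_zero fb fM.
have [h fK hK] := fb; have f_inj := can_inj fK.
have low e : (e <= 1)%N -> (expo (f (gen v e)) <= 1)%N.
  move=> e1; rewrite leqNgt; apply/negP=> fe.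
  have [x [y xy]] : exists x y : model v', f (gen v e) = (x * y)%g.
    rewrite -[f _]expoK; case: (expo _) fe (expo_le (f (gen v e))) => [|[|n]] // _ nc.
    by exists (gen v' 1), (gen v' n.+1); rewrite -genS.
  have := gen_prod (h x) (h y); rewrite -(fK (h x * h y)%g) fM !hK -xy fK genK; lia.
have dif : expo (f (gen v 0)) <> expo (f (gen v 1)).
  by move/(can_inj (@expoK c v'))/f_inj/(@gen_inj c v 0 1 isT isT).
have E0 : f (gen v 0) = gen v' (expo (f (gen v 0))) by rewrite expoK.
have E1 : f (gen v 1) = gen v' (expo (f (gen v 1))) by rewrite expoK.
have := paramP v; have := paramP v'; move: good (genM v) (genM v').
case: (param v) => -[p q] k; case: (param v') => -[p' q'] k' good m m'.
move=> /and5P[c1 pc' qc' kc' _] /and5P[_ pc qc kc _].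
have ab := m 1 0 isT isT; have ba := m 0 1 isT isT; have bb := m 0 0 isT isT.
have ab' := m' 1 0 isT isT; have ba' := m' 0 1 isT isT; have bb' := m' 0 0 isT isT.
rewrite /mul_expo /= in ab ba bb ab' ba' bb'.
have {E0 E1 dif} [[E0 E1]|[E0 E1]] : f (gen v 0) = gen v' 0 /\ f (gen v 1) = gen v' 1 \/
    f (gen v 0) = gen v' 1 /\ f (gen v 1) = gen v' 0.
  move: (low 0 isT) (low 1 isT) dif; rewrite E0 E1 !genK ?expo_le //.
  by case: (expo _) => [|[|]] //; case: (expo _) => [|[|]] //; [left | right].
- have fg e : (0 < e <= c.+1)%N -> f (gen v e) = gen v' e.
    elim: e => // -[|e] IH ec //; have ec' : (0 < e.+1 <= c)%N by lia.
    by rewrite (genS v ec') (genS v' ec') fM E1 IH //; lia.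
  have /gen_inj hp : gen v' (minn (1 + p) c.+1) = gen v' (minn (1 + p') c.+1).
    by rewrite -ab' -E0 -E1 -fM ab fg //; lia.
  have /gen_inj hq : gen v' (minn (q + 1) c.+1) = gen v' (minn (q' + 1) c.+1).
    by rewrite -ba' -E0 -E1 -fM ba fg //; lia.
  have /gen_inj hk : gen v' k = gen v' k' by rewrite -bb' -E0 -fM bb fg //; lia.
  by congr (_, _, _); [apply: succn_inj; lia | apply: succn_inj; lia | apply: hk; lia].
have fg n : (n.+2 <= c.+1)%N -> f (gen v n.+2) = gen v' (minn (k' + n * q') c.+1).
  elim: n => [|n IH] nc; first by rewrite genS // fM E1 bb'; congr gen; lia.
  have ec' : (0 < n.+2 <= c)%N by lia.
  rewrite (genS v ec') fM E1 IH ?m' //; try lia.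
  by congr gen; rewrite /mul_expo /=; case: ifP => e0; lia.
(* The image of a^c is b^c = a^(k' + (c - 2) q'), and it is not zero. *)
have k2 : k' = 2.
  have := fg (c - 2)%N; have -> : (c - 2).+2 = c by lia.
  move=> /(_ (leqnSn c)) fc; have : gen v c != szero by rewrite gen_eq0 //; lia.
  rewrite -(inj_eq f_inj) f0 fc gen_eq0 ?geq_minr //; nia.
have [p1 q1] := good k2; subst k' p' q'.
have f2 : f (gen v 2) = gen v' 2 by rewrite fg //; congr gen; lia.
have /f_inj/gen_inj hp : f (gen v (minn (1 + p) c.+1)) = f (gen v 2).
  by rewrite -ab fM E0 E1 ba' f2; congr gen; lia.
have /f_inj/gen_inj hq : f (gen v (minn (q + 1) c.+1)) = f (gen v 2).
  by rewrite -ba fM E0 E1 ab' f2; congr gen; lia.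
have /f_inj/gen_inj hk : f (gen v k) = f (gen v 2).
  by rewrite -bb fM E0 m' // f2; congr gen; rewrite /mul_expo /=; lia.
congr (_, _, _); [have := hp _ _ | have := hq _ _ | have := hk _ _]; lia.
Qed.
(** * Labels *)

Lemma exactly_seq (T : Type) (I : eqType) (L : seq I) (g : I -> T) (P : T -> Prop) :
  uniq L -> {in L &, injective g} ->
  (forall x, P x <-> exists2 i, i \in L & x = g i) -> exactly (size L) P.
Proof.
move=> uL gL PE; exists (fun i => g (tnth (in_tuple L) i)); split=> [i j|x].
  by move/gL; rewrite !mem_tnth => /(_ isT isT); apply/(tuple_uniqP (in_tuple L)).
rewrite PE; split=> [[i iL ->]|[i ->]]; last by exists (tnth (in_tuple L) i);
  rewrite ?mem_tnth.
by have /tnthP[j ->] : i \in in_tuple L by []; exists j.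
Qed.

Section Labels.
Variable K : fieldType.

(** In an algebra with this presentation, uv is the product of the scalars
    l(u) l(v) and of a^2, where l picks the coordinate on a. *)
Lemma pres2_rank1 (S : finSemigroup0) : pres 2 Main (contracted K S) ->
  exists l : S -> K, forall s t, (s * t)%g = szero <-> l s * l t = 0.
Proof.
move=> [E [Es Em] ker].
have [u uE] := choice (fun s => Es (of_sg K s)).
exists (fun s => (u s).1`_0) => s t.
rewrite -(of_sg_eq0 K) of_sgM !uE Em ker /pmul twist_main scale0r addr0 /=.
rewrite -mulrA; split=> [[/(_ 1 isT)]|z].
  by rewrite coefXM coef0M.
by split=> // -[|[|//]] _; rewrite coefXM //= coef0M.
Qed.

(** By [pres2_rank1] the products ab, ba and b^2 vanish together. *)
Lemma kind_of_main2 (v : model_param 2) : pres 2 Main (contracted K (model v)) ->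
  kind_of 2 (param v) = Main.
Proof.
move/pres2_rank1=> [l lE]; have := paramP v; have m := genM v.
have := gen_eq0 v; move: m; case: (param v) => -[p q] k m g0 /and5P[_ pc qc kc _].
have A : l (gen v 1) != 0.
  apply/eqP=> h; have /lE : l (gen v 1) * l (gen v 1) = 0 by rewrite h mulr0.
  by rewrite m // => /eqP; rewrite g0.
have ab : (p == 2) = (l (gen v 0) == 0).
  have -> : (p == 2) = ((gen v 1 * gen v 0)%g == szero) by rewrite m // /mul_expo g0;
    lia.
  by apply/eqP/eqP=> [/lE/eqP|h]; [rewrite mulf_eq0 (negPf A) => /eqP | apply/lE;
    rewrite h mulr0].
have ba : (q == 2) = (l (gen v 0) == 0).
  have -> : (q == 2) = ((gen v 0 * gen v 1)%g == szero) by rewrite m // /mul_expo g0;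
    lia.
  by apply/eqP/eqP=> [/lE/eqP|h];
    [rewrite mulf_eq0 (negPf A) orbF => /eqP | apply/lE; rewrite h mul0r].
have bb : (k == 3) = (l (gen v 0) == 0).
  have -> : (k == 3) = ((gen v 0 * gen v 0)%g == szero) by rewrite m // /mul_expo g0
    //=; lia.
  by apply/eqP/eqP=> [/lE/eqP|h]; [rewrite mulf_eq0 orbb => /eqP | apply/lE;
    rewrite h mul0r].
rewrite /kind_of; have -> : (p == q) by move: ab ba; case: (_ == 0); lia.
by have -> : (k == minn p.*2 3) by move: ab bb; case: (_ == 0); lia.
Qed.

(** In class 2 some product xy is not zero; if l(x) l(y) is not zero, then neither is
    l(x)^2. *)
Lemma long_power (S : finSemigroup0) c : has_class (szero : S) c ->
  #|[set x : S | x != szero]| = c.+1 ->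
  (2 < c)%N \/ c = 2 /\ pres 2 Main (contracted K S) ->
  exists a : S, spow a c.-1 != szero.
Proof.
move=> cl card [c2|[cE /pres2_rank1[l lE]]]; first exact: cyclic_generator c2.
apply: contrapT => no; have := cl.2 1%N; rewrite cE => h.
suff /h : vanishing (szero : S) 1 by [].
move=> x [|y []] // _; have lz a : l a = 0.
  apply/eqP; rewrite -sqrf_eq0 expr2; apply/eqP/lE/eqP; apply: contrapT => /negP aa.
  by apply: no; exists a; rewrite cE.
by apply/lE; rewrite lz mul0r.
Qed.

(** The kind [SqM] arises for 2p = c only, and then c is even. *)
Lemma kind_of_admissible c x : (2 < c)%N -> valid c x -> admissible c (kind_of c x).
Proof.
case: x => -[p q] k c2 /and5P[c1 pc qc kc h]; move: h; rewrite /kind_of.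
case: eqVneq => [->|_ _]; last by case: ifP; rewrite /admissible /= c2.
case: (eqVneq k (minn q.*2 c.+1)) => [_ _|kE]; first exact: (ltnW c1).
case: (eqVneq k c) => [_ _|kc' h]; rewrite /admissible /= c2 //=.
suff -> : c = q.*2 by rewrite odd_double.
by move: h; case: ifP; lia.
Qed.

Lemma canon_main (t : kind) : canon K t = canon K Main -> t = Main.
Proof. by rewrite /canon andbF; case: ifP. Qed.

Lemma model_good c x : valid c x -> (2 < c)%N \/ kind_of c x = Main ->
  let: (p, q, k) := x in k = 2%N -> p = 1%N /\ q = 1%N.
Proof.
case: x => -[p q] k /and5P[c1 pc qc kc h] h' k2; subst k.
case: h' => [c2|].
  move: h; case: eqVneq => [->|_] /=; last by lia.
  case: ifP; lia.
rewrite /kind_of; case: eqVneq => [->|_]; last by case: ifP.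
by case: eqVneq; [lia | case: ifP].
Qed.

(** Every semigroup with this contracted algebra is isomorphic to one model, whose
    parameters are an invariant and determine the kind of the algebra. *)
Lemma label_pres c t (L : seq (nat * nat * nat)) :
  admissible c t -> (1 < c)%N -> uniq L ->
  (forall x, x \in L <-> valid c x /\ canon K (kind_of c x) = canon K t) ->
  label 1 (pres (K := K) c t) (size L).
Proof.
move=> at1 c1 uL LE.
have at2 : (2 < c)%N \/ c = 2 /\ t = Main.
  have [c2|c2] := ltnP 2 c; [by left | right]; split; first by lia.
  by move: at1; rewrite /admissible; case: (t =P Main) => // _; rewrite (ltnNge 2) c2.
have tyM x : canon K (kind_of c x) = canon K t -> (2 < c)%N \/ kind_of c x = Main.
  by case: at2 => [h _|[_ ->] h]; [left | right; apply: canon_main].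
have pm (v : model_param c) : param v \in L -> pres c t (contracted K (model v)).
  move/LE=> [_ e]; rewrite -pres_canon -e pres_canon; apply: pres_model.
  by case: (tyM _ e) => [->|->]; rewrite ?orbT.
pose g x : sgtype := fun T => exists2 v :
  model_param c, param v = x & sg_iso (model v) T.
have gE (v : model_param c) : g (param v) = sg_isotype (model v).
  apply/funext=> T; apply/propext; split=> [[w wv]|h]; last by exists v.
  case: v w wv => [x vx] [y vy] /= yx; rewrite yx in vy *.
  by rewrite (bool_irrelevance vy vx).
apply: (exactly_seq (g := g) uL) => [x y /LE[vx ex] /LE[vy ey]|X].
  rewrite -[x]/(param (ModelParam vx)) -[y]/(param (ModelParam vy)) !gE =>
    /sg_isotype_eq.
  by apply: model_inj; apply: (model_good vy (tyM y ey)).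
split=> [[S [[c' [cl card]] pS ->]]|[x xL ->]]; last first.
  have [vx ex] := (LE x).1 xL; pose v := ModelParam vx; exists (model v).
  have pv : pres c t (contracted K (model v)) by apply: pm.
  split=> //; last exact: (gE v).
  exists c; split; last by rewrite model_card addn1.
  by apply/(class_contracted K); apply: pres_class pv; apply: admissible_gt1.
have cc : c' = c.
  by apply: has_class_uniq (pres_class (admissible_gt1 at1) pS); apply/class_contracted.
subst c'; rewrite addn1 in card.
have [|a ac] := long_power cl card.
  by case: at2 => [|[cE tE]]; [left | right; split=> //; rewrite -tE -[X in pres X]cE].
have [v vS] := iso_model cl card c1 ac.
have pv : pres c t (contracted K (model v)).
  by apply: pres_iso pS; apply/contracted_iso/sg_iso_sym.
exists (param v); last by rewrite gE; apply/sg_isotype_eq/sg_iso_sym.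
apply/LE; split; first exact: paramP.
case: at2 => [c2|[cE tE]]; last first.
  by subst c t; rewrite kind_of_main2.
have pv' : pres c (kind_of c (param v)) (contracted K (model v)) by apply:
  pres_model; rewrite c2.
by have [_ ->] := pres_inj (kind_of_admissible c2 (paramP v)) at1 pv' pv.
Qed.

End Labels.
Section Enumeration.
Variables (c : nat).
Hypothesis c1 : (1 < c)%N.

(** The coefficient of b^2 after the substitution vanishes exactly for
    k = min(2p, c + 1), one value for each p. *)
Definition main_params := [seq (p, p, minn p.*2 c.+1) | p <- iota 1 c].
Definition sqp_params := [seq (p, p, c) | p <- iota c./2.+1 (c - c./2)].
Definition sqm_params := [:: (c./2, c./2, c.+1)].
Definition nc_params (k : nat) := [:: (c.-1, c, k); (c, c.-1, k)].

Lemma main_paramsP x : x \in main_params <-> valid c x /\ kind_of c x = Main.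
Proof.
split=> [/mapP[p]|].
  rewrite mem_iota => pc ->; rewrite /kind_of !eqxx; split=> //=.
  by rewrite eqxx c1; case: ifP; lia.
case: x => -[p q] k [/and5P[_ pc qc kc h]]; rewrite /kind_of.
case: eqVneq => [<-|_] /=; last by case: ifP.
case: (k =P minn p.*2 c.+1) => [-> _|_]; last by case: ifP.
by apply/mapP; exists p => //; rewrite mem_iota; lia.
Qed.

Lemma sqp_paramsP x : x \in sqp_params <-> valid c x /\ kind_of c x = SqP.
Proof.
have hc := odd_double_half c; split=> [/mapP[p]|].
  rewrite mem_iota => pc ->; rewrite /kind_of !eqxx.
  have -> : (c == minn p.*2 c.+1) = false by lia.
  by split=> //=; rewrite eqxx c1; case: ifP; lia.
case: x => -[p q] k [/and5P[_ pc qc kc h]]; move: h; rewrite /kind_of.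
case: eqVneq => [<-|_] /=; last by case: ifP.
case: (k =P minn p.*2 c.+1) => // kE; case: (k =P c) => // kc' h _; subst k.
apply/mapP; exists p => //; rewrite mem_iota.
by move: h; case: ifP; lia.
Qed.

Lemma sqm_paramsP x : ~~ odd c -> x \in sqm_params <-> valid c x /\ kind_of c x = SqM.
Proof.
move=> oc; have hc := even_halfK oc; rewrite inE; split=> [/eqP ->|].
  rewrite /kind_of eqxx; have -> : (c.+1 == minn c./2.*2 c.+1) = false by lia.
  have -> : (c.+1 == c) = false by lia.
  by split=> //=; rewrite eqxx c1; case: ifP; lia.
case: x => -[p q] k [/and5P[_ pc qc kc h]]; move: h; rewrite /kind_of.
case: eqVneq => [<-|_] /=; last by case: ifP.
case: (k =P minn p.*2 c.+1) => // kE; case: (k =P c) => // kc' h _.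
by apply/eqP; congr (_, _, _); move: h; case: ifP; lia.
Qed.

Lemma nc1_paramsP x : x \in nc_params c <-> valid c x /\ kind_of c x = Nc1.
Proof.
rewrite !inE; have e1 : (c.-1 == c) = false by lia.
have e2 : (c == c.-1) = false by lia.
split=> [/orP[]/eqP ->|]; first by rewrite /kind_of e1 eqxx; split=> //=; lia.
  by rewrite /kind_of e2 eqxx; split=> //=; lia.
case: x => -[p q] k [/and5P[_ pc qc kc h]]; rewrite /kind_of.
have [pq|pq] := boolP (p == q); first by do 2?case: ifP.
rewrite (negPf pq) /= in h; case: (k =P c) => // -> _; rewrite !xpair_eqE; lia.
Qed.

Lemma nc0_paramsP x : x \in nc_params c.+1 <-> valid c x /\ kind_of c x = Nc0.
Proof.
rewrite !inE; have e1 : (c.-1 == c) = false by lia.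
have e2 : (c == c.-1) = false by lia.
have e3 : (c.+1 == c) = false by lia.
split=> [/orP[]/eqP ->|]; first by rewrite /kind_of e1 e3; split=> //=; lia.
  by rewrite /kind_of e2 e3; split=> //=; lia.
case: x => -[p q] k [/and5P[_ pc qc kc h]]; rewrite /kind_of.
have [pq|pq] := boolP (p == q); first by do 2?case: ifP.
rewrite (negPf pq) /= in h; case: (k =P c) => // kc' _; rewrite !xpair_eqE; lia.
Qed.

End Enumeration.

Lemma admissible_shift c t i : admissible c t -> admissible (c + i.*2) t.
Proof.
rewrite /admissible; case: (t == Main) => [|/andP[c2]]; first by lia.
by rewrite oddD odd_double addbF => ->; rewrite andbT; lia.
Qed.

Lemma canon_sq (K : fieldType) t : (exists i : K, i ^+ 2 = -1) ->
  canon K t = if t == SqM then SqP else t.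
Proof. by rewrite /canon => /asboolP ->. Qed.

Lemma canon_nsq (K : fieldType) t : ~ (exists i : K, i ^+ 2 = -1) -> canon K t = t.
Proof. by rewrite /canon => /asboolPn/negPf ->. Qed.

Lemma canon_only (K : fieldType) u t : u \in [:: Main; Nc0; Nc1] ->
  canon K t = canon K u <-> t = u.
Proof.
have [/canon_sq E|/canon_nsq E] := pselect (exists i : K, i ^+ 2 = -1);
  last by rewrite !E.
by rewrite !E; case: u => // _; case: t.
Qed.

(** For [SqP] the parameters of [SqM] have to be added if -1 is a square; these exist
    for even c only, so the numbers are linear along each parity of c but not
    overall. *)
Lemma label_linear (K : fieldType) c t : admissible c t -> (1 < c)%N ->
  exists a b, forall i, label 1 (pres (K := K) (c + i.*2) t) (a + b * i)%N.
Proof.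
move=> at1 c1; have ci i : (1 < c + i.*2)%N by lia.
wlog red : t at1 / t = SqM -> ~ (exists i : K, i ^+ 2 = -1) => [W|].
  have [[tE sq]|h] := pselect (t = SqM /\ exists i : K, i ^+ 2 = -1); last first.
    by apply: W => // tE sq; apply: h.
  subst t; have [||a [b h]] := W SqP; rewrite //.
    by move: at1; rewrite /admissible /= => /andP[->].
  by exists a, b => i; rewrite -pres_canon (canon_sq _ sq).
have lab (L : nat -> seq (nat * nat * nat)) a b :
    (forall i, uniq (L i)) -> (forall i, size (L i) = a + b * i)%N ->
    (forall i x, x \in L i <->
       valid (c + i.*2) x /\ canon K (kind_of (c + i.*2) x) = canon K t) ->
    exists a b, forall i, label 1 (pres (K := K) (c + i.*2) t) (a + b * i)%N.
  move=> uL sL LE; exists a, b => i; rewrite -sL.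
  exact: label_pres (admissible_shift i at1) (ci i) (uL i) (LE i).
have only u (L : nat -> seq (nat * nat * nat)) i x : t = u -> u \in [:: Main; Nc0;
  Nc1] ->
    (x \in L i <-> valid (c + i.*2) x /\ kind_of (c + i.*2) x = u) ->
    x \in L i <-> valid (c + i.*2) x /\ canon K (kind_of (c + i.*2) x) = canon K t.
  by move=> -> /(canon_only K) uE ->; split=> -[? /uE].
have even i : odd (c + i.*2) = odd c by rewrite oddD odd_double addbF.
have half i : (c + i.*2)./2 = (c./2 + i)%N by rewrite halfD odd_double andbF doubleK.
have sqp_uniq d : uniq (sqp_params d).
  by rewrite map_inj_uniq ?iota_uniq // => p q [].
case tE: t at1 red => at1 red.
- rewrite -tE; apply: (lab (fun i => main_params (c + i.*2)) c 2) => [i|i|i x].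
  + by rewrite map_inj_uniq ?iota_uniq // => p q [].
  + by rewrite size_map size_iota; lia.
  + exact/(only _ (fun i => main_params (c + i.*2)))/main_paramsP.
- have [sq|nsq] := pselect (exists i : K, i ^+ 2 = -1); last first.
    rewrite -tE; apply: (lab (fun i => sqp_params (c + i.*2)) (c - c./2)%N 1) =>
      [i|i|i x] //.
      by rewrite size_map size_iota half; lia.
    by rewrite sqp_paramsP // tE !canon_nsq.
  have [oc|oc] := boolP (odd c).
    rewrite -tE; apply: (lab (fun i => sqp_params (c + i.*2)) (c - c./2)%N 1) =>
      [i|i|i x] //.
      by rewrite size_map size_iota half; lia.
    rewrite sqp_paramsP // tE !canon_sq //=; split=> -[vx]; first by move=> ->.
    case: eqP => [e|//] _; have := kind_of_admissible _ vx.
    rewrite e /admissible /= even oc andbF; move: at1;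
      rewrite /admissible /= => /andP[c2 _].
    by move=> /(_ ltac:(lia)).
  rewrite -tE; apply: (lab (fun i =>
    sqp_params (c + i.*2) ++ sqm_params (c + i.*2)) (c - c./2).+1 1) => [i|i|i x].
  + rewrite cat_uniq sqp_uniq /= andbT orbF; apply/mapP=> -[p _ [_ _]]; lia.
  + by rewrite size_cat size_map size_iota half /=; lia.
  + have E := sqm_paramsP (ci i) x; rewrite even in E.
    rewrite mem_cat -(rwP orP) sqp_paramsP // E // tE !canon_sq //=.
    split=> [[[vx ->]|[vx ->]] //|[vx]].
    by case: eqP => [e _|_ e]; [right | left].
- have nsq := red erefl; have oc : ~~ odd c by move: at1;
  rewrite /admissible /= => /andP[].
  rewrite -tE; apply: (lab (fun i => sqm_params (c + i.*2)) 1 0)%N => [i|i|i x] //.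
  by rewrite sqm_paramsP ?even // tE !canon_nsq.
- rewrite -tE; apply: (lab (fun i => nc_params (c + i.*2) (c + i.*2).+1) 2 0)%N =>
  [i|i|i x] //.
    by rewrite /= inE !xpair_eqE; lia.
  exact/(only _ (fun i => nc_params (c + i.*2) (c + i.*2).+1))/nc0_paramsP.
- rewrite -tE; apply: (lab (fun i => nc_params (c + i.*2) (c + i.*2)) 2 0)%N =>
  [i|i|i x] //.
    by rewrite /= inE !xpair_eqE; lia.
  exact/(only _ (fun i => nc_params (c + i.*2) (c + i.*2)))/nc1_paramsP.
Qed.
(** * The coclass graph *)

Lemma quot_power_iso (K : fieldType) (A B : assocAlgType K) m :
  alg_iso A B -> alg_iso (quot_power A m) (quot_power B m).
Proof.
have img (C D : assocAlgType K) (f : {linear C -> D}) x :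
    {morph f : x y / (x * y)%g} -> x \in power_ideal C m -> f x \in power_ideal D m.
  move=> fM /asboolP[s [sP ->]]; apply/asboolP; exists [seq (p.1, f p.2) | p <- s].
  split=> [p /mapP[q /sP[y [t [tm qE]]] ->] /=|].
    by exists (f y), (map f t); rewrite size_map qE lprod_morph.
  by rewrite linear_sum big_map; apply: eq_bigr => p _; rewrite linearZ.
move=> [f [h fK hK] fM].
pose E : {linear A -> quot_power A m} := @qpi K A (power_ideal A m).
pose E' : {linear A -> quot_power B m} := @qpi K B (power_ideal B m) \o f.
apply: (@alg_iso_of_covers _ _ (fun x y => x * y)%g _ _ E E').
- exact: qpi_surj.
- by move=> y; have [z ->] := qpi_surj y; exists (h z); rewrite /E' /= hK.
- move=> x; rewrite /E /E' /= !qpi_eq0; split; first exact: img.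
  have hlin : linear h by move=> a y z; apply: (can_inj fK); rewrite linearP !hK.
  pose H : {linear B -> A} := HB.pack h (GRing.isLinear.Build K B A *:%R h hlin).
  rewrite -{2}(fK x); apply: (img _ _ H) => y z; rewrite /H /=.
  by apply: (can_inj fK); rewrite fM !hK.
- by move=> x y; rewrite /E /= -qpiM.
- by move=> x y; rewrite /E' /= -qpiM fM.
Qed.

Section TwoGenerators.
Variables (K : fieldType) (S : finSemigroup0) (a b : S).
Local Notation A := (contracted K S).
Hypothesis ab : a != b.
Hypotheses (a0 : a != szero) (b0 : b != szero).
Hypotheses (na : ~ long_product 1 a) (nb : ~ long_product 1 b).
Hypothesis others : forall s, s != szero -> [\/ s = a, s = b | long_product 1 s].

(** Modulo the second power only the generators survive, and they stay linearly
    independent because products of algebra elements only involve products of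
    semigroup elements. *)
Lemma pres_two_generators : pres 1 Main (quot_power A 2).
Proof.
pose p : {linear A -> quot_power A 2} := @qpi K A (power_ideal A 2).
have pM u v : (p u * p v)%g = 0.
  rewrite /p /= -qpiM; apply/qpi_eq0/asboolP; exists [:: (1, (u * v)%g)].
  rewrite big_seq1 scale1r; split=> // q; rewrite inE => /eqP -> /=.
  by exists u, [:: v].
have pdeep s : long_product 1 s -> p (of_sg K s) = 0.
  move=> [y [t [t1 ->]]]; case: t t1 => [|z [|]] // _.
  by rewrite -[lprod _ _]/(y * z)%g of_sgM /p /= qpiM pM.
apply: (@pres_of_gens _ _ (p (of_sg K a)) (p (of_sg K b))) => //=;
  rewrite ?pM ?scale0r ?scaler0 //.
- move=> x; have [y ->] := qpi_surj x; have [f ->] := comb_surj y.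
  exists (fun=> f a), (f b); rewrite big_ord_recl big_ord0 addr0 /=.
  rewrite -[qpi _ _]/(p _) /comb linear_sum (bigD1 a) //= (bigD1 b) 1?eq_sym //=.
  rewrite big1 ?addr0 => [|s /andP[sa sb]]; first by rewrite !linearZ.
  suff ps : p (of_sg K s) = 0 by rewrite linearZ ps; apply: scaler0.
  have [->|/others[e|e|/pdeep //]] := eqVneq s szero.
  + by rewrite (of_sg_eq0 _ _).2 // raddf0.
  + by rewrite e eqxx in sa.
  + by rewrite e eqxx in sb.
move=> f d; rewrite big_ord_recl big_ord0 addr0 /= => e.
have /qpi_eq0/power_supported[g gE gs] : p (f ord0 *: of_sg K a + d *: of_sg K b) = 0.
  by rewrite -e linearD !linearZ.
have g0 s : ~ long_product 1 s -> g s = 0.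
  by move=> ns; apply/eqP; apply: contrapT => /negP /gs.
pose C : {linear {ffun S -> K^o} -> A} := @comb K S.
(* Compare the coefficients at the generators, where g vanishes. *)
pose h : {ffun S -> K^o} := f ord0 *: (sg_basis K a : {ffun S -> K^o})
  + d *: (sg_basis K b : {ffun S -> K^o}) - g.
have /comb_eq0 hz : C h = 0.
  rewrite /h linearB linearD !linearZ /C /= -gE /of_sg !qpi_comb.
  exact: subrr.
have := hz a a0; have := hz b b0; rewrite !ffunE !g0 // !eqxx (eq_sym b) (negPf ab).
rewrite !subr0 /GRing.scale /= !mulr0 !mulr1 addr0 add0r => -> fa; split=> // i.
by rewrite (ord1 i).
Qed.
End TwoGenerators.
Section Vertices.
Variable K : fieldType.
Local Notation pres := (@pres K).

(** The class of a vertex is the class of its algebras, see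
    [vertex_of_class_class]. *)
Definition vertex_of_class (c : nat) (B : algtype K) : Prop :=
  exists S : finSemigroup0, [/\ has_class (szero : S) c,
    #|[set x : S | x != szero]| = c.+1 & B = isotype (contracted K S)].

Lemma vertexP B : vertex 1 B <-> exists2 c, (0 < c)%N & vertex_of_class c B.
Proof.
split=> [[S [c [cl card]] BE]|[c _ [S [cl card BE]]]]; last first.
  by exists S => //; exists c; rewrite addn1.
rewrite addn1 in card; exists c; last by exists S.
exact: class_gt0 cl card.
Qed.

Lemma vertex_of_class_class c B (b : assocAlgType K) : vertex_of_class c B -> B b ->
  has_class (0 : b) c.
Proof. by move=> [S [cl _ ->]] /alg_iso_class; apply; apply/class_contracted. Qed.

Lemma vertex_of_class_inhabited c B : vertex_of_class c B -> exists b, B b.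
Proof. by move=> [S [_ _ ->]]; exists (contracted K S); apply: alg_iso_refl. Qed.

Lemma vertex_of_class_uniq c d B : vertex_of_class c B -> vertex_of_class d B -> c = d.
Proof.
move=> cB dB; have [b Bb] := vertex_of_class_inhabited cB.
exact: has_class_uniq (vertex_of_class_class cB Bb) (vertex_of_class_class dB Bb).
Qed.

Lemma vertex_of_class_pres c B : (2 < c)%N -> vertex_of_class c B ->
  exists2 t, admissible c t & B = pres c t.
Proof.
move=> c2 [S [cl card ->]]; have [a ac] := cyclic_generator cl card c2.
have [v vS] := iso_model cl card (ltnW c2) ac.
exists (kind_of c (param v)); first exact: kind_of_admissible (paramP v).
apply: isotype_pres; apply: pres_iso (contracted_iso K vS) _.
by apply: pres_model; rewrite c2.
Qed.

Lemma params_kind c t : admissible c t -> (1 < c)%N ->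
  exists v : model_param c, kind_of c (param v) = t.
Proof.
move=> at1 c1; suff [x [vx <-]] :
  exists x, valid c x /\ kind_of c x = t by exists (ModelParam vx).
case: t at1 => at1.
- exists (1, 1, 2)%N; apply/main_paramsP=> //; apply/mapP; exists 1%N;
  first by rewrite mem_iota; lia.
  by congr (_, _, _); lia.
- exists (c, c, c); apply/sqp_paramsP=> //; apply/mapP; exists c => //.
  by have := odd_double_half c; rewrite mem_iota; lia.
- exists (c./2, c./2, c.+1); apply/sqm_paramsP; rewrite ?inE //.
  by move: at1; rewrite /admissible /= => /andP[].
- by exists (c.-1, c, c.+1); apply/nc0_paramsP; rewrite ?inE ?eqxx.
- by exists (c.-1, c, c); apply/nc1_paramsP; rewrite ?inE ?eqxx.
Qed.

Lemma pres_vertex_gt1 c t : admissible c t -> (1 < c)%N -> vertex_of_class c (pres c t).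
Proof.
move=> at1 c1; have [v vt] := params_kind at1 c1.
have pv : pres c t (contracted K (model v)).
  rewrite -vt; apply: pres_model; rewrite vt.
  by move: at1; rewrite /admissible; case: eqP => [_|_ /andP[->]] //; rewrite orbT.
exists (model v); split; last by rewrite (isotype_pres pv).
  by apply/(class_contracted K); apply: pres_class pv; apply: admissible_gt1.
exact: model_card.
Qed.

Lemma vertex_of_class1 B : vertex_of_class 1 B -> B = pres 1 Main.
Proof.
move=> [S [cl card ->]]; apply: isotype_pres.
have d0 (s : S) : long_product 1 s -> s = szero by apply: (long_product_eq0 cl).
have [x0 [s [_ ne]]] := longest_word cl card.
have x00 : x0 != szero.
  apply: contraNneq ne => ->; apply/eqP; elim: s => // u s IH.
  by rewrite /lprod /= mul0s.
have [|//|z [z0 zx all]] := @remaining S 1 card (fun=> x0).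
  by move=> i j _; rewrite (ord1 i) (ord1 j).
pose p : {linear contracted K S -> quot_power (contracted K S) 2} :=
  @qpi K _ (power_ideal (contracted K S) 2).
pose i : {linear contracted K S -> contracted K S} := idfun.
apply: pres_iso (pres_two_generators K (zx ord0) z0 x00 _ _ _).
- apply: (@alg_iso_of_covers _ _ (fun x y => x * y)%g _ _ p i) => //.
  + exact: qpi_surj.
  + by move=> y; exists y.
  + move=> u; rewrite /i /p /= qpi_eq0; split=> [/power_supported[g -> gs]|->].
      by apply/comb_eq0=> t t0; apply/eqP; apply: contraNT t0 => /gs/d0 ->.
    exact: rpred0.
  + by move=> x y; rewrite /p /= -qpiM.
- by move/d0=> e; rewrite e eqxx in z0.
- by move/d0=> e; rewrite e eqxx in x00.
- by move=> t /all[->|[_ ->]]; [constructor 1 | constructor 2].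
Qed.

(** The element z left over by the two prefixes x0 and x0 g1 of a non-zero product
    is a generator. If z were a product, then x0 would be the only generator, and
    x0 x0 the only non-zero product. *)
Lemma vertex_of_class2_quot B (b : assocAlgType K) : vertex_of_class 2 B -> B b ->
  pres 1 Main (quot_power b 2).
Proof.
move=> [S [cl card ->]] /(quot_power_iso 2)/pres_iso; apply.
have d0 (s : S) : long_product 2 s -> s = szero by apply: (long_product_eq0 cl).
have [x0 [s [s1 ne]]] := longest_word cl card.
case: s s1 ne => [|g1 [|]] // _; rewrite -[lprod _ _]/(x0 * g1)%g => ne.
have d1 (u w : S) : long_product 1 (u * w)%g by apply/long_product_mull/long_product0.
have nd (u w : S) : (u * w)%g != szero -> ~ long_product 1 u /\ ~ long_product 1 w.
  move=> uw; split=> d; case/eqP: uw; apply: d0; first exact: long_product_mulr.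
  exact: long_product_mull.
have x00 : x0 != szero by apply: contraNneq ne => ->; rewrite mul0s.
pose f (i : 'I_2) : S := if val i == 0 then x0 else (x0 * g1)%g.
have [||z [z0 zf all]] := @remaining S 2 card f.
- move=> i j; rewrite /f; case: i => -[|[|//]] ip; case: j => -[|[|//]] jp //= e.
  + exact: val_inj.
  + by move/(fixed_mulr cl): e x00 => ->; rewrite eqxx.
  + by move/esym/(fixed_mulr cl): e x00 => ->; rewrite eqxx.
  + exact: val_inj.
- by move=> i; rewrite /f; case: ifP.
have zx0 : z != x0 by apply: (zf ord0).
have zx : z != (x0 * g1)%g by apply: (zf ord_max).
have {}all t : t != szero -> [\/ t = x0, t = z | t = (x0 * g1)%g].
  move=> /all[->|[i ->]]; first by constructor 2.
  by rewrite /f; case: ifP; [constructor 1 | constructor 3].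
have [nx0 ng1] := nd _ _ ne.
have nz : ~ long_product 1 z.
  move=> dz.
  have gen u : ~ long_product 1 u -> u != szero -> u = x0.
    by move=> nu /all[//|e|e]; case: nu; rewrite e.
  have uw : forall u w, (u * w)%g != szero -> (u * w)%g = (x0 * x0)%g.
    move=> u w h; have [nu nw] := nd _ _ h.
    have uE : u = x0 by apply: gen => //; apply: contraNneq h => ->; rewrite mul0s.
    have wE : w = x0 by apply: gen => //; apply: contraNneq h => ->; rewrite muls0.
    by rewrite uE wE.
  have [y [t [t1 zE]]] := dz; case: t t1 zE => [|w [|]] // _ zE.
  have zyw : z = (y * w)%g by [].
  case/eqP: zx; rewrite zyw (uw y w); last by rewrite -zyw.
  by rewrite (uw x0 g1).
apply: (@pres_two_generators K S x0 z) => //; first by rewrite eq_sym.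
by move=> t /all[->|->|->]; [constructor 1 | constructor 2 | constructor 3].
Qed.

Lemma vertex_of_class_KZ : vertex_of_class 1 (KZ K 3).
Proof.
exists (zero_semigroup 3); split=> //.
  split=> [x [|y [|]] //|[|d] // v].
  by have := v (inord 1 : 'I_3) [::] erefl; move/(congr1 val); rewrite /= inordK.
have -> : [set x : zero_semigroup 3 | x != szero] = [set~ szero] by apply/setP=> x;
  rewrite !inE.
by rewrite cardsC1 [#|_|](card_ord 3).
Qed.

Lemma KZ3 : KZ K 3 = pres 1 Main.
Proof. exact/vertex_of_class1/vertex_of_class_KZ. Qed.

Lemma pres_vertex c t : admissible c t -> vertex_of_class c (pres c t).
Proof.
move=> at1; have [c1|c1] := ltnP 1 c; first exact: pres_vertex_gt1.
suff [-> ->] : c = 1%N /\ t = Main by rewrite -KZ3; apply: vertex_of_class_KZ.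
move: at1; rewrite /admissible; case: (t =P Main) => [->|_ /andP[c2 _]];
  last by exfalso; lia.
by split=> //; lia.
Qed.

Lemma vertex_of_class_main c : (0 < c)%N -> vertex_of_class c (pres c Main).
Proof. exact: (@pres_vertex c Main). Qed.

Lemma main_inj c d : (0 < c)%N -> (0 < d)%N -> pres c Main = pres d Main -> c = d.
Proof.
by move=> c0 d0 e; apply: (@vertex_of_class_uniq _ _ (pres c Main)); [|rewrite e];
  apply: vertex_of_class_main.
Qed.

(** The parent of a vertex only depends on its class, as in every presentation
    the deviation from the algebra on the infinite path lies in the last power. *)
Lemma edgeP A B : edge 1 A B <->
  exists c, [/\ (0 < c)%N, A = pres c Main & vertex_of_class c.+1 B].
Proof.
split=> [[/vertexP[e e0 eA] /vertexP[d d0 dB] [b [c' [Bb clb Aq]]]]|[c [c0 -> cB]]].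
  have {clb} c'd : c' = d := has_class_uniq clb (vertex_of_class_class dB Bb); subst c'.
  have AE : A = isotype (quot_power b d).
    by move: eA Aq => [S [_ _ ->]] /isotype_eq.
  case: d d0 dB AE Aq => // -[|c] _ dB AE Aq.
    have [_ /(_ 0%N)] := vertex_of_class_class eA Aq; rewrite leqNgt e0 => h.
    suff /h : vanishing (0 : quot_power b 1) 0 by [].
    move=> x [] // _; have [y ->] := qpi_surj x; apply/qpi_eq0/asboolP.
    exists [:: (1, y)]; rewrite big_seq1 scale1r; split=> // q.
    by rewrite inE => /eqP -> /=; exists y, [::].
  exists c.+1; split=> //; rewrite AE; apply: isotype_pres.
  case: c dB {AE Aq} => [|c] dB; first exact: vertex_of_class2_quot dB Bb.
  have [t _ BE] := vertex_of_class_pres (isT : 2 < c.+3)%N dB.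
  by rewrite BE in Bb; apply: pres_quot Bb.
split.
- by apply/vertexP; exists c; last exact: vertex_of_class_main.
- by apply/vertexP; exists c.+1.
have [b Bb] := vertex_of_class_inhabited cB; exists b, c.+1; split=> //;
  first exact: vertex_of_class_class cB Bb.
case: c c0 cB => // -[|c] _ cB; first exact: vertex_of_class2_quot cB Bb.
have [t _ BE] := vertex_of_class_pres (isT : 2 < c.+3)%N cB.
by rewrite BE in Bb; apply: pres_quot Bb.
Qed.

(** Below a vertex of the infinite path lies every vertex of larger class, as the
    parent of a vertex of class d is the path vertex of class d - 1. *)
Lemma subtreeP c B : (0 < c)%N ->
  subtree 1 (pres c Main) B <-> B = pres c Main \/ exists2 d, (c < d)%N &
    vertex_of_class d B.
Proof.
move=> c0; split.
  move=> /(Operators_Properties.clos_rt_rtn1 _ _ _ _) h.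
  elim: h => [|y z /edgeP[e [e0 yE ez]] _ IH]; first by left.
  right; exists e.+1 => //; case: IH => [yE'|[d cd dy]].
    by rewrite (main_inj c0 e0) // -yE.
  by rewrite ltnW // ltnS (vertex_of_class_uniq (vertex_of_class_main e0) _ :
    e = d) // -yE.
have path d : (c <= d)%N -> subtree 1 (pres c Main) (pres d Main).
  elim: d => [|d IH]; first by rewrite leqn0 => /eqP ->; apply: rt_refl.
  rewrite leq_eqVlt => /predU1P[->|cd]; first exact: rt_refl.
  apply: (rt_trans _ _ _ _ _ (IH cd)); apply: rt_step; apply/edgeP; exists d;
    split=> //.
    by apply: leq_trans c0 cd.
  exact: vertex_of_class_main.
move=> [->|[[|d] // cd dB]]; first exact: rt_refl.
apply: (rt_trans _ _ _ _ _ (path d cd)); apply: rt_step; apply/edgeP; exists d;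
  split=> //.
exact: leq_trans c0 cd.
Qed.

End Vertices.
(** * The maximal coclass tree and its periodicity *)

Section Shift.
Variable K : fieldType.
Local Notation pres := (@pres K).

Definition main_path (j : nat) : algtype K := pres j.+1 Main.

Lemma main_path_infinite : infinite_path 1 main_path.
Proof. by move=> j; apply/edgeP; exists j.+1; split=> //;
  apply: vertex_of_class_main. Qed.

Lemma infinite_path_main P : infinite_path 1 P -> P 0%N = main_path 0 -> P = main_path.
Proof.
move=> Pi P0; apply/funext; elim=> // j IH.
have /edgeP[c [c0 jE cj]] := Pi j; have /edgeP[d [d0 dE _]] := Pi j.+1.
rewrite dE in cj *; rewrite IH in jE.
by rewrite -(vertex_of_class_uniq cj (vertex_of_class_main K d0)) -(main_inj _ c0 jE).
Qed.

Lemma root_main : is_root 1 (main_path 0).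
Proof.
split; first by apply/vertexP; exists 1%N; last exact: vertex_of_class_main.
move=> B /edgeP[c [c0 _ cB]].
by have := vertex_of_class_uniq cB (vertex_of_class_main K (isT : 0 < 1)%N);
  case: (c) c0.
Qed.

Lemma vertex_subtree B : vertex 1 B -> subtree 1 (main_path 0) B.
Proof.
move=> /vertexP[c c0 cB]; apply/subtreeP => //.
case: c c0 cB => // -[|c] _ cB; first by left; apply: vertex_of_class1.
by right; exists c.+2.
Qed.

Lemma coclass_tree_main : coclass_tree 1 (main_path 0).
Proof.
split; first exact: root_main.1.
exists main_path; split; first by split=> //; apply: main_path_infinite.
by move=> Q [Qi Q0]; apply/esym/infinite_path_main.
Qed.

Lemma root_unique A : is_root 1 A -> A = main_path 0.
Proof.
move=> [/vertex_subtree/subtreeP-/(_ isT)[//|[[|c] // c1 cA]] noedge].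
by case: (noedge (pres c Main)); apply/edgeP; exists c.
Qed.

Lemma maximal_coclass_tree_unique A : maximal_coclass_tree 1 A -> A = main_path 0.
Proof.
move=> [_ [/root_unique //|[B [_ [P [Q [[Pi P0] [Qi Q0] []]]]]]]].
by rewrite (infinite_path_main Pi (root_unique P0)) (infinite_path_main Qi
  (root_unique Q0)).
Qed.

(** The vertices below the path vertex of class c, by their presentations. In class c
    itself this is only the path vertex, whence the condition on t. *)
Definition below (c : nat) (B : algtype K) : Prop :=
  exists d t, [/\ admissible d t, (c <= d)%N, d = c -> t = Main & B = pres d t].

Lemma below_subtree c B : (1 < c)%N -> subtree 1 (pres c Main) B <-> below c B.
Proof.
move=> c1; rewrite subtreeP; last exact: ltnW.
split=> [[->|[d cd dB]]|[d [t [dt cd dc ->]]]].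
- by exists c, Main; split=> //; apply: ltnW.
- have [t dt BE] := vertex_of_class_pres (leq_ltn_trans c1 cd) dB.
  by exists d, t; split=> //; [apply: ltnW | move=> dc; rewrite dc ltnn in cd].
move: cd; rewrite leq_eqVlt => /predU1P[cd|cd]; last by right; exists d => //;
  apply: pres_vertex.
by left; rewrite -cd dc.
Qed.

(** Sends the type with presentation (c, t) to the one with presentation (c + 2, t).
    As a union over all presentations of C it needs no choice of one of them; that
    they all give the same result is [pres_eq]. *)
Definition shift (C : algtype K) : algtype K := fun B =>
  exists c t, [/\ admissible c t, C = pres c t & pres c.+2 t B].

Lemma pres_eq c d t u : admissible c t -> admissible d u ->
  pres c t = pres d u <-> c = d /\ canon K t = canon K u.
Proof.
move=> ct du; split=> [e|[-> e]]; last by rewrite -pres_canon e pres_canon.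
have [b Bb] := vertex_of_class_inhabited (pres_vertex K ct); apply: (pres_inj ct du Bb).
by rewrite -e.
Qed.

Lemma admissible2 c t : admissible c t -> admissible c.+2 t.
Proof. by move/(admissible_shift 1); rewrite addn2. Qed.

Lemma shift_pres c t : admissible c t -> shift (pres c t) = pres c.+2 t.
Proof.
move=> ct; apply/funext=> B; apply/propext; split=> [[d [u [du e]]]|Bp].
  have [<- cu] := (pres_eq ct du).1 e.
  by rewrite -pres_canon -cu pres_canon.
by exists c, t.
Qed.

Lemma iter_shift c t i : admissible c t -> iter i shift (pres c t) = pres (c + i.*2) t.
Proof.
move=> ct; elim: i => [|i IH]; first by rewrite addn0.
rewrite iterS IH shift_pres; last exact: admissible_shift.
by rewrite doubleS !addnS.
Qed.

Lemma edge_pres c d t u : admissible c t -> admissible d u ->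
  edge 1 (pres c t) (pres d u) <-> t = Main /\ d = c.+1.
Proof.
move=> ct du; rewrite edgeP; split=> [[e [e0 eE eu]]|[tE dE]]; last first.
  subst t d; exists c; split=> //; exact: pres_vertex.
have [ce /canon_main ->] := (@pres_eq c e t Main ct e0).1 eE; split=> //.
by rewrite ce; apply: vertex_of_class_uniq (pres_vertex K du) eu.
Qed.

Lemma shift_tree_iso : tree_iso 1 (main_path 1) (main_path 3) shift.
Proof.
split.
- move=> C /below_subtree-/(_ isT)[d [t [dt d2 dc ->]]].
  apply/below_subtree=> //; rewrite shift_pres //; exists d.+2, t; split=> //.
    exact: admissible2.
  by move=> [/dc].
- move=> C D /below_subtree-/(_ isT)[c [t [ct c2 cc ->]]].
  move=> /below_subtree-/(_ isT)[d [u [du d2 dc ->]]].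
  rewrite !shift_pres // => /(pres_eq (admissible2 ct) (admissible2 du))[[->] e].
  by rewrite -pres_canon e pres_canon.
- move=> D /below_subtree-/(_ isT)[[|[|d]] [t [dt d4 dc ->]]] //.
  have dt' : admissible d t.
    move: dt; rewrite /admissible /= negbK; case: (t =P Main) => [_ _|tM /andP[_ h]];
      first by lia.
    rewrite h andbT ltnNge; apply/negP=> d2; apply: tM; apply: dc; lia.
  exists (pres d t); last exact: shift_pres.
  apply/below_subtree=> //; exists d, t; split=> //.
  by move=> d2; apply: dc; rewrite d2.
move=> C D /below_subtree-/(_ isT)[c [t [ct c2 cc ->]]].
move=> /below_subtree-/(_ isT)[d [u [du d2 dc ->]]].
rewrite !shift_pres // !edge_pres //; try exact: admissible2.
by split=> -[-> e]; split=> //; [rewrite e | case: e].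
Qed.

(** The difference of the two subtrees consists of the classes 2, 3 and 4, without
    the root of the lower subtree, the path vertex of class 4. *)
Lemma in_diff_pres B : in_diff 1 (main_path 1) (main_path 3) B <->
  B = main_path 1 \/ exists c t, [/\ admissible c t, c = 3 \/ c = 4 /\ t <> Main & B
    = pres c t].
Proof.
rewrite /in_diff !below_subtree //; split=> [[[d [t [dt d2 dc BE]]] nB]|].
  have [d4|d4] := leqP 4 d.
    right; exists d, t; split=> //; right.
    case: (t =P Main) => [tM|tM].
      by case: nB; exists d, t.
    split=> //; apply/eqP; rewrite eq_sym eqn_leq d4 /= leqNgt; apply/negP=> d5.
    by case: nB; exists d, t; split=> // dE; rewrite dE in d5.
  have [d3|d3] := eqVneq d 3; first by right; exists d, t; split=> //; left.
  have dE : d = 2 by lia.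
  by left; rewrite BE dE (dc dE).
move=> [->|[c [t [ct h ->]]]].
  split; first by exists 2, Main.
  move=> [d [t [dt d4 _ /(pres_eq (isT : admissible 2 Main) dt)[dE _]]]].
  by rewrite -dE in d4.
split.
  exists c, t; split=> //; first by case: h => [->|[->]].
  by case: h => [->|[->]].
move=> [d [u [du d4 dc /(pres_eq ct du)[cd tu]]]]; subst d.
case: h => [c3|[c4 tM]]; first by rewrite c3 in d4.
by apply: tM; apply: (@canon_main K); rewrite tu (dc c4).
Qed.

Lemma shift_periodic : exists f : algtype K -> {poly rat},
  strongly_virtually_periodic_with 1 main_path 2 2 shift f /\
  forall B, in_diff 1 (main_path 1) (main_path 3) B -> (size (f B) <= 2)%N.
Proof.
pose good B (p : {poly rat}) := in_diff 1 (main_path 1) (main_path 3) B ->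
  (size p <= 2)%N /\ forall i : nat, exists2 n, label 1 (iter i shift B) n & p.[i%:R]
    = n%:R.
have [B|f fP] := @choice _ _ good.
  have [inB|nB] := pselect (in_diff 1 (main_path 1) (main_path 3) B); last by exists 0.
  have [c [t [ct c1 ->]]] : exists c t, [/\ admissible c t, (1 < c)%N & B = pres c t].
    case/in_diff_pres: inB => [->|[c [t [ct h ->]]]]; first by exists 2, Main.
    by exists c, t; split=> //; case: h => [->|[->]].
  have [a [b lab]] := label_linear K ct c1.
  exists (a%:R%:P + b%:R *: 'X) => _; split=> [|i].
    rewrite (leq_trans (size_polyD _ _)) // geq_max (leq_trans (size_polyC_leq1 _)) //=.
    by rewrite (leq_trans (size_scale_leq _ _)) // size_polyX.
  exists (a + b * i)%N; first by rewrite iter_shift.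
  by rewrite !hornerE natrD natrM.
exists f; split=> [|B /fP[]//].
split=> //.
- by split; [exact: coclass_tree_main | left; exact: root_main].
- exact: main_path_infinite.
- exact: shift_tree_iso.
- by move=> B /fP[].
Qed.

Local Notation D := (in_diff 1 (main_path 1) (main_path 3)).

Lemma child2P B : (D B /\ edge 1 (main_path 1) B) <->
  exists2 t, t \in [:: Main; SqP; Nc0; Nc1] & B = pres 3 t.
Proof.
rewrite in_diff_pres; split=> [[[->|[c [t [ct h ->]]]] e]|[t tL ->]].
- by have [_] := (edge_pres (isT : admissible 2 Main) (isT : admissible 2 Main)).1 e.
- have [_ c3] := (edge_pres (isT : admissible 2 Main) ct).1 e; subst c.
  by exists t => //; case: (t) ct.
have t3 : admissible 3 t by case: (t) tL.
by split; [right; exists 3, t; split=> //; left | apply/edge_pres].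
Qed.

Lemma child3P B : (D B /\ edge 1 (main_path 2) B) <->
  exists2 t, t \in [:: SqP; SqM; Nc0; Nc1] & B = pres 4 t.
Proof.
rewrite in_diff_pres; split=> [[[->|[c [t [ct h ->]]]] e]|[t tL ->]].
- by have [_] := (edge_pres (isT : admissible 3 Main) (isT : admissible 2 Main)).1 e.
- have [_ c4] := (edge_pres (isT : admissible 3 Main) ct).1 e; subst c.
  by exists t => //; case: h => // -[_]; case: (t).
have t4 : admissible 4 t by case: (t).
split; last by apply/edge_pres.
by right; exists 4, t; split=> //; right; split=> // tM; rewrite tM in tL.
Qed.

Lemma diff_children B : D B <->
  [\/ B = main_path 1, D B /\ edge 1 (main_path 1) B | D B /\ edge 1 (main_path 2) B].
Proof.
split=> [DB|[->|[]|[]] //]; last by apply/in_diff_pres; left.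
have /in_diff_pres[->|[c [t [ct [c3|[c4 tM]] BE]]]] := DB; first by constructor 1.
- by constructor 2; split=> //; subst c B; apply/edge_pres.
- by constructor 3; split=> //; subst c B; apply/edge_pres.
Qed.

Lemma exactly_pres c (L : seq kind) (P : algtype K -> Prop) :
  uniq L -> (forall t, t \in L -> admissible c t) ->
  {in L &, injective (canon K)} ->
  (forall B, P B <-> exists2 t, t \in L & B = pres c t) -> exactly (size L) P.
Proof.
move=> uL aL cL PE; apply: exactly_seq uL _ PE => t u tL uL'.
by move=> /(pres_eq (aL _ tL) (aL _ uL'))[_]; apply: cL.
Qed.

End Shift.

(** * The infinite path *)

Section InfinitePath.
Variable K : fieldType.
Local Notation F := ({poly K} * K^o)%type.

Lemma poly_ideal_proof (p : {poly K}) : 'X * p \in @const0 K.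
Proof. by rewrite inE coefXM. Qed.

(** I_K consists of the multiples X P, which matches P(a) a with a = X and b a
    generator of L_K. *)
Definition cover_M1 (u : F) : M1 K := (PolyIdeal (poly_ideal_proof u.1), u.2).

Fact cover_M1_is_linear : linear cover_M1.
Proof.
move=> a u v; congr pair; apply: val_inj => /=.
by rewrite mulrDr scalerAr.
Qed.

HB.instance Definition _ :=
  GRing.isLinear.Build K F (M1 K) *:%R cover_M1 cover_M1_is_linear.

(** The kind [Main] has no correction term, so the class is arbitrary here. *)
Lemma covers_M1 : covers 0 Main (cover_M1 : {linear F -> M1 K}).
Proof.
split=> [[[p p0] d]|u v].
  have /lowP[q pE] : low 1 p by case=> // _; move: p0; rewrite inE => /eqP.
  by exists (q, d); congr pair; apply: val_inj; rewrite /= pE expr1.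
rewrite /pmul twist_main scale0r addr0; congr pair; apply: val_inj => /=.
by ring.
Qed.

Lemma M1_infinite_dimensional : infinite_dimensional (M1 K).
Proof.
move=> [n [e span]]; pose N := \max_i size (val (e i).1).
(* A polynomial of degree N + 1 is out of reach of finitely many of degree below N. *)
have [a aE] := span (cover_M1 ('X^N, 0)).
pose top (x : M1 K) := (val x.1)`_N.+1.
have topD : {morph top : x y / x + y} by move=> x y; rewrite /top /= coefD.
have top0 : top 0 = 0 by rewrite /top /= coef0.
have := congr1 top aE; rewrite (big_morph top topD top0) big1 => [|i _].
  by rewrite /top /= coefXM coefXn eqxx => /eqP; rewrite oner_eq0.
rewrite /top /= coefZ nth_default ?mulr0 // leqW //.
exact: (leq_bigmax i).
Qed.

Lemma M1_describes : describes (M1 K) (@main_path K).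
Proof.
split; first exact: M1_infinite_dimensional.
have KZa : KZ K 3 (contracted K (zero_semigroup 3)) by apply: alg_iso_refl.
exists (contracted K (zero_semigroup 3)), 1%N; split.
- by rewrite /main_path -KZ3.
- exact: vertex_of_class_class (vertex_of_class_KZ K) KZa.
case=> // j _; rewrite addn1 /=.
apply: (quot_cover covers_M1) => //= u [/(congr1 val) /= u1 ->]; split=> // i _.
have := congr1 (fun s : seq K => s`_i.+1) u1.
by rewrite coefXM coef0.
Qed.
End InfinitePath.

Theorem theorem8 (K : fieldType) :
  (* (1): the graph is T(KZ_3), the unique maximal coclass tree *)
  [/\ is_root 1 (KZ K 3),
      maximal_coclass_tree 1 (KZ K 3),
      (forall B : algtype K, vertex 1 B -> subtree 1 (KZ K 3) B) &
      (forall A : algtype K, maximal_coclass_tree 1 A -> A = KZ K 3)] /\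
  (* A_j = P j.-1 *)
  exists P : nat -> algtype K,
    [/\ infinite_path 1 P, P 0%N = KZ K 3 & describes (M1 K) P] /\
    (* (2) *)
    (exists (mu : algtype K -> algtype K) (f : algtype K -> {poly rat}),
       strongly_virtually_periodic_with 1 P 2 2 mu f /\
       (forall B, in_diff 1 (P 1%N) (P 3%N) B -> (size (f B) <= 2)%N)) /\
    let D := in_diff 1 (P 1%N) (P 3%N) in
    let child A B := D B /\ edge 1 A B in
    [/\ (forall B, D B <-> [\/ B = P 1%N, child (P 1%N) B | child (P 2%N) B]),
        exactly 4 (child (P 1%N)),
        ((exists i : K, i ^+ 2 = -1) -> exactly 3 (child (P 2%N))) &
        (~ (exists i : K, i ^+ 2 = -1) -> exactly 4 (child (P 2%N)))].
Proof.
rewrite KZ3; split.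
  split; first exact: root_main.
  - by split; [exact: coclass_tree_main | left; exact: root_main].
  - exact: vertex_subtree.
  - exact: maximal_coclass_tree_unique.
exists (@main_path K); split.
  by split; [exact: main_path_infinite | | exact: M1_describes].
split; first by exists (shift (K := K)); apply: shift_periodic.
move=> D child; split.
- exact: diff_children.
- apply: (@exactly_pres K 3 [:: Main; SqP; Nc0; Nc1]) (@child2P K) => //.
    by do 4!case=> //.
  move=> t u; have [sq|nsq] := pselect (exists i : K, i ^+ 2 = -1).
    by rewrite !canon_sq //; case: t; case: u.
  by rewrite !canon_nsq.
- move=> sq; apply: (@exactly_pres K 4 [:: SqP; Nc0; Nc1]) => //.
  + by case.
  + by move=> t u; rewrite !canon_sq //; case: t; case: u.
  move=> B; split=> [/child3P[t tL ->]|[t tL ->]]; last first.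
    by apply/child3P; exists t => //; case: (t) tL.
  exists (canon K t); last by rewrite pres_canon.
  by rewrite canon_sq //; case: (t) tL.
- move=> nsq; apply: (@exactly_pres K 4 [:: SqP; SqM; Nc0; Nc1]) (@child3P K) => //.
  + by case.
  + by move=> t u _ _; rewrite !canon_nsq.
Qed.
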